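(* Let $H_i,H:[0,T]\times\mathbb{R}^n\times\mathbb{R}^n\to\mathbb{R}$, $i\in\mathbb{N}$, be admissible (see context). Let $(\mathbb{R}^{n+1},f_i,l_i)$ and $(\mathbb{R}^{n+1},f,l)$ be the canonical noncompact representations of $H_i$ and $H$, respectively (see context). If for all $t\in[0,T]$ the functions $H_i(t,\cdot,\cdot)$ converge to $H(t,\cdot,\cdot)$ uniformly on compact sets, then for all $t\in[0,T]$ the functions $f_i(t,\cdot,\cdot)$ converge to $f(t,\cdot,\cdot)$ and $l_i(t,\cdot,\cdot)$ converge to $l(t,\cdot,\cdot)$ uniformly on compact subsets of $\mathbb{R}^n\times\mathbb{R}^{n+1}$. Furthermore, if there are measurable $c_i,c:[0,T]\to[0,\infty)$ with $|H_i(t,x,p)-H_i(t,x,q)|\le c_i(t)(1+|x|)|p-q|$ and $|H(t,x,p)-H(t,x,q)|\le c(t)(1+|x|)|p-q|$ for all $t\in[0,T]$, $x,p,q\in\mathbb{R}^n$, $i\in\mathbb{N}$, then $|f_i(t,x,a)|\le c_i(t)(1+|x|)$ and $|f(t,x,a)|\le c(t)(1+|x|)$ for all $t\in[0,T]$, $x\in\mathbb{R}^n$, $a\in\mathbb{R}^{n+1}$, $i\in\mathbb{N}$.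
   Context: $|\cdot|$ is the Euclidean norm, $B(y,r)$ is the closed ball with center $y$ and radius $r\ge0$, $B_R$ is the closed ball in $\mathbb{R}^n$ centered at $0$ with radius $R$, $d(y,K):=\inf_{z\in K}|y-z|$. A null set is a set of Lebesgue measure zero. A modulus is a function $w:[0,T]\times[0,\infty)\to[0,\infty)$ such that $w(\cdot,r)$ is measurable for every $r\ge0$ and, for every $t$, $w(t,\cdot)$ is nondecreasing, continuous, subadditive and $w(t,0)=0$. A function $H:[0,T]\times\mathbb{R}^n\times\mathbb{R}^n\to\mathbb{R}$ is called admissible if $H(\cdot,x,p)$ is measurable for all $(x,p)$, $H(t,\cdot,\cdot)$ is continuous for every $t$, $H(t,x,\cdot)$ is convex for every $(t,x)$, and for every $R>0$ there are a measurable $k_R:[0,T]\to[0,\infty)$, a modulus $w_R$ and a null set $\mathcal{N}_R$ such that $|H(t,x,p)-H(t,y,p)|\le k_R(t)|p||x-y|+w_R(t,|x-y|)$ for all $t\in[0,T]\setminus\mathcal{N}_R$, $x,y\in B_R$, $p\in\mathbb{R}^n$. (These data may be different for each $H_i$.) Steiner point: for a nonempty convex compact $K\subset\mathbb{R}^m$ let $\sigma(K,p):=\max_{x\in K}\langle p,x\rangle$, and let $m(\partial\sigma(K,p))$ be the element of minimal norm of the subdifferential of the convex function $\sigma(K,\cdot)$ at $p$. Then $s_m(K):=\frac{1}{\mathrm{vol}(B)}\int_{B}m(\partial\sigma(K,p))\,dp\in K$, where $B$ is the closed unit ball of $\mathbb{R}^m$. Canonical noncompact representation: for admissible $H$ put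 $L(t,x,v):=\sup_{p\in\mathbb{R}^n}\{\langle v,p\rangle-H(t,x,p)\}$ and $E_L(t,x):=\{(v,\eta)\in\mathbb{R}^n\times\mathbb{R}: L(t,x,v)\le\eta\}$, which is a nonempty closed convex subset of $\mathbb{R}^{n+1}$. For $a\in\mathbb{R}^{n+1}$ define $e(t,x,a):=s_{n+1}\big(E_L(t,x)\cap B(a,2d(a,E_L(t,x)))\big)\in\mathbb{R}^{n+1}$, and define $f(t,x,a)\in\mathbb{R}^n$, $l(t,x,a)\in\mathbb{R}$ by $e(t,x,a)=(f(t,x,a),l(t,x,a))$. The triple $(\mathbb{R}^{n+1},f,l)$ is the canonical noncompact representation of $H$. *)

(* Defs.v *)
From HB Require Import structures.
From mathcomp Require Import all_boot all_order all_algebra.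
From mathcomp Require Import all_classical all_reals all_analysis.
From mathcomp Require Import measurable_realfun.

Set Implicit Arguments.
Unset Strict Implicit.
Unset Printing Implicit Defensive.

Import Order.TTheory GRing.Theory Num.Theory.
Import numFieldNormedType.Exports.

Local Open Scope classical_set_scope.
Local Open Scope ring_scope.

Definition dot (R : realType) (m : nat) (x y : 'rV[R]_m) : R :=
  \sum_(i < m) x ord0 i * y ord0 i.

(* The library's norm on 'rV[R]_m is the max norm. It is equivalent to enorm,
   so its topology and uniform structure are the Euclidean ones. *)
Definition enorm (R : realType) (m : nat) (x : 'rV[R]_m) : R :=
  Num.sqrt (dot x x).

Definition eball (R : realType) (m : nat) (y : 'rV[R]_m) (r : R) :
    set 'rV[R]_m :=
  [set z | enorm (z - y) <= r].

Definition edist (R : realType) (m : nat) (y : 'rV[R]_m)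
    (K : set 'rV[R]_m) : R :=
  inf [set enorm (y - z) | z in K].

(* Lebesgue, not only Borel, measurability: the domain carries the completion
   of the Borel sigma-algebra. *)
Definition lebesgue_measurable_fun (R : realType) (D : set R) (f : R -> R) :
    Prop :=
  @measurable_fun _ _
    (g_sigma_algebraType (completed_algebra_gen (@lebesgue_measure R)))
    (measurableTypeR R) D f.

Section lebesgue_tuple.
Context (R : realType).
Local Notation mR := (measurableTypeR R).

Definition tuple_cons (m : nat) (p : mR * m.-tuple mR) : m.+1.-tuple mR :=
  [tuple of p.1 :: p.2].

Definition tuple_uncons (m : nat) (q : m.+1.-tuple mR) : mR * m.-tuple mR :=
  (thead q, [tuple of behead q]).

Lemma measurable_tuple_cons (m : nat) : measurable_fun setT (@tuple_cons m).
Proof. exact: measurable_cons. Qed.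

Lemma measurable_tuple_uncons (m : nat) :
  measurable_fun setT (@tuple_uncons m).
Proof.
apply/measurable_fun_pairP; split; first exact: measurable_tnth.
exact: measurable_behead.
Qed.

Lemma tuple_consK (m : nat) : cancel (@tuple_cons m) (@tuple_uncons m).
Proof. by move=> [x t]; congr pair; apply/val_inj. Qed.

Section succ.
Variables (m : nat) (mu : {sigma_finite_measure set (m.-tuple mR) -> \bar R}).

Definition lebesgue_tuple_succ : set (m.+1.-tuple mR) -> \bar R :=
  pushforward (lebesgue_measure \x mu)%E (@tuple_cons m).

Let nu : {measure set (m.+1.-tuple mR) -> \bar R} :=
  measure_function_pushforward__canonical__measure_function_Measure
    (lebesgue_measure \x mu)%E (@measurable_tuple_cons m).

HB.instance Definition _ := isMeasure.Build _ _ _ lebesgue_tuple_succ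
  (measure0 nu) (measure_ge0 nu) (@measure_semi_sigma_additive _ _ _ nu).

Let lebesgue_tuple_succ_sigma_finite : sigma_finite setT lebesgue_tuple_succ.
Proof.
have /sigma_finiteP[F [FT ndF Foo]] := sigma_finiteT (@lebesgue_measure R).
have /sigma_finiteP[G [GT ndG Goo]] := sigma_finiteT mu.
exists (fun k => @tuple_uncons m @^-1` (F k `*` G k)).
  rewrite -preimage_bigcup (_ : \bigcup_k _ = setT) ?preimage_setT//.
  apply/seteqP; split=> // -[x y] _.
  have [i _ Fix] : (\bigcup_k F k) x by rewrite -FT.
  have [j _ Gjy] : (\bigcup_k G k) y by rewrite -GT.
  exists (maxn i j) => //; split => /=.
    by move: Fix; apply/subsetPset/ndF/leq_maxl.
  by move: Gjy; apply/subsetPset/ndG/leq_maxr.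
move=> k; have [mF Fk] := Foo k; have [mG Gk] := Goo k; split.
  rewrite -[X in measurable X]setTI.
  by apply: measurable_tuple_uncons => //; exact: measurableX.
rewrite /lebesgue_tuple_succ /pushforward -comp_preimage.
rewrite (_ : _ \o _ = id); last by apply/funext => p /=; rewrite tuple_consK.
by rewrite preimage_id product_measure1E// lte_mul_pinfty// ge0_fin_numE.
Qed.

HB.instance Definition _ := Measure_isSigmaFinite.Build _ _ _
  lebesgue_tuple_succ lebesgue_tuple_succ_sigma_finite.

End succ.

Fixpoint lebesgue_tuple (m : nat) :
    {sigma_finite_measure set (m.-tuple mR) -> \bar R} :=
  match m with
  | 0 => dirac ([tuple] : 0.-tuple mR)
  | m'.+1 => lebesgue_tuple_succ (lebesgue_tuple m')
  end.

End lebesgue_tuple.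

Section steiner.
Context (R : realType) (m : nat).
Implicit Types (K A : set 'rV[R]_m) (p x : 'rV[R]_m).

(* On a nonempty compact set K the supremum is attained, hence is a maximum. *)
Definition support_fun K p : R := sup [set dot p x | x in K].

Definition subdifferential (g : 'rV[R]_m -> R) p : set 'rV[R]_m :=
  [set x | forall q, g p + dot x (q - p) <= g q].

(* The point of least Euclidean norm of A (0 by convention if there is none);
   it is unique when A is convex. *)
Definition min_norm_elt A : 'rV[R]_m :=
  xget 0 [set x | A x /\ forall y, A y -> enorm x <= enorm y].

Definition row_of_tuple (p : m.-tuple (measurableTypeR R)) : 'rV[R]_m :=
  \row_(i < m) tnth p i.

Definition unit_ball : set (m.-tuple (measurableTypeR R)) :=
  row_of_tuple @^-1` eball 0 1.

Definition steiner K : 'rV[R]_m :=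
  \row_(i < m)
    ((fine (lebesgue_tuple R m unit_ball))^-1 *
     \int[lebesgue_tuple R m]_(p in unit_ball)
       min_norm_elt (subdifferential (support_fun K) (row_of_tuple p)) ord0 i).

End steiner.

Section hamiltonian.
Context (R : realType) (T : R) (n : nat).

Record modulus (w : R -> R -> R) : Prop := {
  modulus_ge0 : forall t r, t \in `[0, T] -> 0 <= r -> 0 <= w t r;
  modulus_measurable : forall r, 0 <= r ->
    lebesgue_measurable_fun `[0, T] (fun t => w t r);
  modulus_nondecreasing : forall t r s, t \in `[0, T] ->
    0 <= r -> r <= s -> w t r <= w t s;
  modulus_continuous : forall t, t \in `[0, T] ->
    {within `[0, +oo[, continuous (w t)};
  modulus_subadditive : forall t r s, t \in `[0, T] ->
    0 <= r -> 0 <= s -> w t (r + s) <= w t r + w t s;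
  modulus_at0 : forall t, t \in `[0, T] -> w t 0 = 0 }.

(* A function with domain [0,T] is represented by a function on R, of which
   only the values on [0,T] are constrained or used. *)
Record admissible (H : R -> 'rV[R]_n -> 'rV[R]_n -> R) : Prop := {
  admissible_measurable : forall x p,
    lebesgue_measurable_fun `[0, T] (fun t => H t x p);
  admissible_continuous : forall t, t \in `[0, T] ->
    continuous (fun z : 'rV[R]_n * 'rV[R]_n => H t z.1 z.2);
  admissible_convex : forall t, t \in `[0, T] -> forall x,
    convex_function [set: 'rV[R]_n] (H t x);
  admissible_x : forall r, 0 < r ->
    exists (k : R -> R) (w : R -> R -> R) (N : set R),
      [/\ lebesgue_measurable_fun `[0, T] k,
          (forall t, t \in `[0, T] -> 0 <= k t),
          modulus w,
          (@lebesgue_measure R).-negligible N &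
          forall t, t \in `[0, T] -> ~ N t ->
          forall x y p, eball 0 r x -> eball 0 r y ->
            `|H t x p - H t y p| <=
              k t * enorm p * enorm (x - y) + w t (enorm (x - y))] }.

End hamiltonian.

Section representation.
Context (R : realType) (n : nat) (H : R -> 'rV[R]_n -> 'rV[R]_n -> R).

Definition lagrangian (t : R) (x v : 'rV[R]_n) : \bar R :=
  ereal_sup (range (fun p => (dot v p - H t x p)%:E)).

(* R^(n+1) is 'rV[R]_(n + 1): lsubmx gives the first n coordinates and rsubmx
   the last one. *)
Definition epi_lagrangian (t : R) (x : 'rV[R]_n) : set 'rV[R]_(n + 1) :=
  [set z | (lagrangian t x (lsubmx z) <= (rsubmx z ord0 ord0)%:E)%E].

Definition repr_e (t : R) (x : 'rV[R]_n) (a : 'rV[R]_(n + 1)) :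
    'rV[R]_(n + 1) :=
  let E := epi_lagrangian t x in
  steiner (E `&` eball a (2 * edist a E)).

Definition repr_f (t : R) (x : 'rV[R]_n) (a : 'rV[R]_(n + 1)) : 'rV[R]_n :=
  lsubmx (repr_e t x a).

Definition repr_l (t : R) (x : 'rV[R]_n) (a : 'rV[R]_(n + 1)) : R :=
  rsubmx (repr_e t x a) ord0 ord0.

End representation.

(* Uniform convergence on compact sets of functions of two variables. *)
Definition cvg_compact (U V : topologicalType) (W : uniformType)
    (g_ : nat -> U -> V -> W) (g : U -> V -> W) : Prop :=
  {family compact, (fun i (z : U * V) => g_ i z.1 z.2) @ \oo -->
                   (fun z : U * V => g z.1 z.2)}.

(* Main.v *)
Require Import Defs.
From HB Require Import structures.
From mathcomp Require Import all_boot all_order all_algebra.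
From mathcomp Require Import all_classical all_reals all_analysis.
From mathcomp Require Import measurable_realfun.
From mathcomp Require Import ring lra.

Set Implicit Arguments.
Unset Strict Implicit.
Unset Printing Implicit Defensive.

Import Order.TTheory GRing.Theory Num.Theory.
Import numFieldNormedType.Exports.

Local Open Scope classical_set_scope.
Local Open Scope ring_scope.

(** Fix [t]. The Hamiltonians are continuous in [(x, p)] and convex in the
momentum [p]. Write [E(h)] for the epigraph of the conjugate of a convex
function [h], so that the representation at [(x, a)] is the Steiner point of
the truncation of [E(H(t, x, .))] to the ball around [a] of twice the distance
of [a]. It suffices to show continuous convergence: if [i] tends to infinity
and [(y, b)] to [(x, a)], the Steiner points for [H_i], [y], [b] tend to the
one for [H], [x], [a]. Uniformity on compact sets follows by a covering
argument ([continuous_cvg_compact]). There are three steps.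

Convex duality. The epigraphs converge in the sense of Painleve and Kuratowski.
A point outside the limit violates a strict inequality, which persists
([limsup_conjugate_epi]). A point of the limit is approximated by points of the
approximating epigraphs ([liminf_conjugate_epi]); these come from the
minimisation of the tilted functions with a small quadratic penalty, whose
optimality condition is a subgradient with small slope ([quadratic_minimum]).

Truncation. For convex sets, this convergence passes to the distances to [a]
and then to the truncations, for which it is Hausdorff convergence
([truncation_near], [near_truncation]). Twice the distance leaves room: a point
of the limit truncation can be moved slightly into the interior of the ball.
Hence the support functions of the truncations converge uniformly on bounded
sets.

Steiner points. Write [f] for a support function and [G z] for the integral of
[f (p + z)] over the unit ball. The coordinates of the Steiner point are, up to
the volume, averages of a subgradient of [f], hence subgradients of [G] at [0]
along the axes ([le_average_subgradient]). Now [G] is differentiable at [0]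
with a modulus that depends only on a Lipschitz constant of [f]: its second
differences compare averages of a bounded function over the ball and over a
shifted ball, and these differ by the measure of a thin annulus
([shifted_integral_near], by translation invariance of Lebesgue measure). So
the averages are approximated, uniformly in [f], by difference quotients of
[G], which depend continuously on [f] ([steiner_continuous]).

The bound on the first component holds because the conjugate of a [C]-Lipschitz
function is finite only in the ball of radius [C], so that the truncated
epigraphs project into this ball, and so does the Steiner point
([steiner_halfspace]): the linearity of the derivative of [G] allows it to be
tested in any direction. *)

(** * Euclidean geometry of row vectors *)

Section euclid.
Context (R : realType) (m : nat).
Implicit Types (x y z : 'rV[R]_m) (a : R).

Lemma dotC x y : dot x y = dot y x.
Proof. by rewrite /dot; apply: eq_bigr => i _; rewrite mulrC. Qed.

Lemma dotDl x y z : dot (x + y) z = dot x z + dot y z.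
Proof.
by rewrite /dot -big_split/=; apply: eq_bigr => i _; rewrite mxE mulrDl.
Qed.

Lemma dotDr x y z : dot x (y + z) = dot x y + dot x z.
Proof. by rewrite dotC dotDl !(dotC x). Qed.

Lemma dotZl a x y : dot (a *: x) y = a * dot x y.
Proof.
by rewrite /dot mulr_sumr; apply: eq_bigr => i _; rewrite mxE mulrA.
Qed.

Lemma dotZr a x y : dot x (a *: y) = a * dot x y.
Proof. by rewrite dotC dotZl (dotC x). Qed.

Lemma dotNl x y : dot (- x) y = - dot x y.
Proof. by rewrite -scaleN1r dotZl mulN1r. Qed.

Lemma dotNr x y : dot x (- y) = - dot x y.
Proof. by rewrite dotC dotNl (dotC x). Qed.

Lemma dotBl x y z : dot (x - y) z = dot x z - dot y z.
Proof. by rewrite dotDl dotNl. Qed.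

Lemma dotBr x y z : dot x (y - z) = dot x y - dot x z.
Proof. by rewrite dotDr dotNr. Qed.

Lemma dot0l x : dot 0 x = 0.
Proof. by rewrite -(scale0r 0) dotZl mul0r. Qed.

Lemma dot0r x : dot x 0 = 0.
Proof. by rewrite dotC dot0l. Qed.

Lemma dot_delta x j : dot x (delta_mx ord0 j) = x ord0 j.
Proof.
rewrite /dot (bigD1 j)//= big1 ?addr0; last first.
  by move=> i ij; rewrite mxE (negbTE ij) andbF mulr0.
by rewrite mxE !eqxx mulr1.
Qed.

Lemma dot_ge0 x : 0 <= dot x x.
Proof. by apply: sumr_ge0 => i _; rewrite -expr2 sqr_ge0. Qed.

Lemma enorm_ge0 x : 0 <= enorm x.
Proof. exact: sqrtr_ge0. Qed.

Lemma sqr_enorm x : enorm x ^+ 2 = dot x x.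
Proof. by rewrite sqr_sqrtr// dot_ge0. Qed.

Lemma enorm0 : enorm (0 : 'rV[R]_m) = 0.
Proof. by rewrite /enorm dot0l sqrtr0. Qed.

Lemma enormZ a x : enorm (a *: x) = `|a| * enorm x.
Proof.
by rewrite /enorm dotZl dotZr mulrA -expr2 sqrtrM ?sqr_ge0// sqrtr_sqr.
Qed.

Lemma enormN x : enorm (- x) = enorm x.
Proof. by rewrite -scaleN1r enormZ normrN1 mul1r. Qed.

Lemma enormBC x y : enorm (x - y) = enorm (y - x).
Proof. by rewrite -enormN opprB. Qed.

Lemma le_coord_enorm x i : `|x ord0 i| <= enorm x.
Proof.
rewrite -sqrtr_sqr /enorm ler_sqrt ?dot_ge0//.
rewrite /dot (bigD1 i)//= -expr2 lerDl; apply: sumr_ge0 => j _.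
by rewrite -expr2 sqr_ge0.
Qed.

Lemma enorm0_eq0 x : enorm x = 0 -> x = 0.
Proof.
move=> x0; apply/rowP => i; rewrite mxE; apply/eqP; rewrite -normr_le0.
by rewrite -x0 le_coord_enorm.
Qed.

Lemma enorm_delta j : enorm (delta_mx ord0 j : 'rV[R]_m) = 1.
Proof. by rewrite /enorm dot_delta mxE !eqxx sqrtr1. Qed.

Lemma dot_le_enorm x y : dot x y <= enorm x * enorm y.
Proof.
have [x0|x0] := eqVneq (enorm x) 0.
  by rewrite (enorm0_eq0 x0) dot0l enorm0 mul0r.
have [y0|y0] := eqVneq (enorm y) 0.
  by rewrite (enorm0_eq0 y0) dot0r enorm0 mulr0.
have x_gt0 : 0 < enorm x by rewrite lt_def x0 enorm_ge0.
have y_gt0 : 0 < enorm y by rewrite lt_def y0 enorm_ge0.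
have := dot_ge0 (enorm y *: x - enorm x *: y).
rewrite dotBl !dotBr !dotZl !dotZr (dotC y x) -!sqr_enorm.
have xy0 : 0 < enorm x * enorm y by rewrite mulr_gt0.
by move=> h; rewrite -(ler_pM2l xy0); nra.
Qed.

Lemma normr_dot_le x y : `|dot x y| <= enorm x * enorm y.
Proof.
by rewrite ler_norml dot_le_enorm lerNl -dotNl -[enorm x]enormN dot_le_enorm.
Qed.

Lemma ler_enormD x y : enorm (x + y) <= enorm x + enorm y.
Proof.
rewrite -(@ler_pXn2r _ 2)// ?nnegrE ?enorm_ge0 ?addr_ge0 ?enorm_ge0//.
rewrite sqr_enorm dotDl !dotDr (dotC y x) -!sqr_enorm.
by have := dot_le_enorm x y; nra.
Qed.

Lemma ler_enorm_distD z x y : enorm (x - y) <= enorm (x - z) + enorm (z - y).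
Proof. by rewrite (le_trans _ (ler_enormD _ _))// addrA subrK. Qed.

Lemma ler_enorm_sum (I : Type) (r : seq I) (P : pred I) (F : I -> 'rV[R]_m) :
  enorm (\sum_(i <- r | P i) F i) <= \sum_(i <- r | P i) enorm (F i).
Proof.
elim/big_ind2 : _ => [|u a v b ua vb|//]; first by rewrite enorm0.
by rewrite (le_trans (ler_enormD _ _))// lerD.
Qed.

Lemma norm_le_enorm x : `|x| <= enorm x.
Proof.
rewrite [leLHS]/Num.norm/= mx_normrE; apply/bigmax_leP; split.
  exact: enorm_ge0.
by move=> [i j] _ /=; rewrite (ord1 i) le_coord_enorm.
Qed.

Lemma le_coord_norm x i : `|x ord0 i| <= `|x|.
Proof.
rewrite [leRHS]/Num.norm /= mx_normrE; apply/bigmax_geP; right.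
by exists (ord0, i).
Qed.

Lemma enorm_le_sum x : enorm x <= \sum_(i < m) `|x ord0 i|.
Proof.
rewrite {1}(row_sum_delta x) (le_trans (ler_enorm_sum _ _ _))//.
by apply: ler_sum => i _; rewrite enormZ enorm_delta mulr1.
Qed.

Lemma enorm_le_norm x : enorm x <= m%:R * `|x|.
Proof.
rewrite (le_trans (enorm_le_sum x))// mulr_natl -[m in _ *+ m]card_ord.
by rewrite -sumr_const; apply: ler_sum => i _; exact: le_coord_norm.
Qed.

Lemma ler_dist_enorm x y : `|enorm x - enorm y| <= enorm (x - y).
Proof.
have := ler_enormD (x - y) y; have := ler_enormD (y - x) x.
by rewrite !subrK (enormBC y x) ler_norml; lra.
Qed.

Lemma near_enorm_lt x (e : R) : 0 < e -> \forall y \near x, enorm (y - x) < e.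
Proof.
move=> e0; have d0 : 0 < e / m.+1%:R by rewrite divr_gt0.
have := nbhsx_ballx x _ d0; rewrite mx_norm_ball; apply: filterS => y /= xy.
rewrite enormBC (le_lt_trans (enorm_le_norm _))//.
rewrite (le_lt_trans (y := m.+1%:R * `|x - y|))// ?ler_wpM2r ?ler_nat//.
by rewrite mulrC -ltr_pdivlMr.
Qed.

Lemma cvg_enorm_lt (I : Type) (F : set_system I) (FF : Filter F)
    (f : I -> 'rV[R]_m) x (e : R) : f @ F --> x -> 0 < e ->
  \forall i \near F, enorm (f i - x) < e.
Proof. by move=> fx e0; exact: (fx _ (near_enorm_lt x e0)). Qed.

Lemma enorm_cvgP (I : Type) (F : set_system I) (FF : Filter F)
    (f : I -> 'rV[R]_m) x :
  (forall e : R, 0 < e -> \forall i \near F, enorm (f i - x) <= e) ->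
  f @ F --> x.
Proof.
move=> fx; apply/cvgrPdist_le => e e0; apply: filterS (fx e e0) => i.
by rewrite distrC; apply: le_trans; exact: norm_le_enorm.
Qed.

Lemma enorm_continuous : continuous (@enorm R m).
Proof.
move=> x; apply/(@cvgrPdist_le _ _ _ (nbhs x)) => e e0.
have := near_enorm_lt x e0; apply: filterS => y xy.
by rewrite (le_trans (ler_dist_enorm _ _))// enormBC ltW.
Qed.

Lemma dot_continuous x : continuous (dot x).
Proof.
move=> y; apply/(@cvgrPdist_le _ _ _ (nbhs y)) => e e0.
have x1 : 0 < enorm x + 1 by rewrite ltr_wpDl ?enorm_ge0.
have := near_enorm_lt y (divr_gt0 e0 x1); apply: filterS => z.
rewrite ltr_pdivlMr// -dotBr -normrN -dotNr opprB => yz.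
rewrite (le_trans (normr_dot_le _ _))// (le_trans _ (ltW yz))//.
by rewrite mulrC ler_wpM2l ?enorm_ge0// lerDl.
Qed.

Lemma enormB_continuous x : continuous (fun y => enorm (y - x)).
Proof.
move=> y; apply/(@cvgrPdist_le _ _ _ (nbhs y)) => e e0.
have := near_enorm_lt y e0; apply: filterS => z yz.
rewrite (le_trans (ler_dist_enorm _ _))//.
by rewrite opprB addrA subrK enormBC ltW.
Qed.

Lemma closed_eball x (r : R) : closed (eball x r).
Proof.
have -> : eball x r = (fun y => enorm (y - x)) @^-1` [set s | s <= r] by [].
apply: preimage_closed; last exact: closed_le.
by move=> y _; exact: enormB_continuous.
Qed.

Lemma eball_compact x (r : R) : compact (eball x r).
Proof.
apply: bounded_closed_compact; last exact: closed_eball.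
exists (enorm x + r); split; first by rewrite num_real.
move=> M /= xrM y; rewrite /eball/= => yx.
rewrite (le_trans (norm_le_enorm _))//.
by have := ler_enormD (y - x) x; rewrite subrK; lra.
Qed.

Lemma closed_eball_compact (A : set 'rV[R]_m) x (r : R) :
  closed A -> compact (A `&` eball x r).
Proof.
move=> cA; apply: (subclosed_compact _ (@eball_compact x r)).
  by apply: closedI => //; exact: closed_eball.
by move=> y [].
Qed.

End euclid.

(** * Lebesgue measure on tuples *)

Section translation.
Context (R : realType).
Local Notation mR := (measurableTypeR R).

Lemma lebesgue_measure_shift (c : R) (A : set mR) : measurable A ->
  lebesgue_measure ((fun x : mR => x + c : mR) @^-1` A) = lebesgue_measure A.
Proof.
move=> mA.
have mc : measurable_fun setT (fun x : mR => x + c : mR).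
  by apply: measurable_funD.
pose nu : {measure set mR -> \bar R} :=
  measure_function_pushforward__canonical__measure_function_Measure
    lebesgue_measure mc.
rewrite -[LHS]/(nu A); apply/esym/lebesgue_measure_unique => //.
move=> _ [[a b] _ <-]; rewrite /nu /= /pushforward.
rewrite (_ : _ @^-1` _ = `]a - c, b - c]%classic); last first.
  by apply/seteqP; split=> x /=; rewrite !in_itv/= ltrBlDr lerBrDr.
rewrite !lebesgue_measure_itv/= !lte_fin ltrD2r.
by case: ifPn => // _; rewrite -!EFinB; congr (_%:E); lra.
Qed.

Definition tuple_shift (m : nat) (z : 'I_m -> R) (p : m.-tuple mR) :
  m.-tuple mR := [tuple (tnth p i + z i : mR) | i < m].

Lemma row_of_tuple_shift (m : nat) (z : 'rV[R]_m) p :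
  row_of_tuple (tuple_shift (z ord0) p) = row_of_tuple p + z.
Proof. by apply/rowP => i; rewrite !mxE tnth_mktuple. Qed.

Lemma tuple_shift_cons (m : nat) (z : 'I_m.+1 -> R) q :
  tuple_shift z (tuple_cons q) =
  tuple_cons (q.1 + z ord0, tuple_shift (fun i => z (lift ord0 i)) q.2).
Proof.
apply: eq_from_tnth => i; rewrite tnth_mktuple.
have [->|i0] := eqVneq i ord0; first by rewrite !tnth0.
case: (unliftP ord0 i) i0 => [j ->|->]; last by rewrite eqxx.
by rewrite !tnthS tnth_mktuple.
Qed.

Lemma measurable_tuple_shift (m : nat) (z : 'I_m -> R) :
  measurable_fun setT (tuple_shift z).
Proof.
apply/measurable_fun_tnthP => i.
rewrite (_ : _ \o _ = fun p => (tnth p i : mR) + z i); last first.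
  by apply/funext => p /=; rewrite tnth_mktuple.
by apply: measurable_funD => //; exact: measurable_tnth.
Qed.

(** Both the product measure and its image under the shift give the product of
the measures of the sides to a rectangle, so the claim passes from [m] to
[m.+1] by uniqueness of product measures. *)
Lemma lebesgue_tuple_shift (m : nat) (z : 'I_m -> R) A : measurable A ->
  lebesgue_tuple R m (tuple_shift z @^-1` A) = lebesgue_tuple R m A.
Proof.
elim: m z A => [|m IH] z A mA.
  by congr (lebesgue_tuple R 0 _); apply/seteqP; split => p; rewrite (tuple0 p) /=
    (tuple0 (tuple_shift _ _)).
pose phi (q : mR * m.-tuple mR) : mR * m.-tuple mR :=
  (q.1 + z ord0, tuple_shift (fun i => z (lift ord0 i)) q.2).
have mphi : measurable_fun setT phi.
  apply/measurable_fun_pairP; split.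
    by apply: measurable_funD.
  exact: (measurableT_comp (measurable_tuple_shift _) measurable_snd).
pose nu : {measure set (mR * m.-tuple mR) -> \bar R} :=
  measure_function_pushforward__canonical__measure_function_Measure
    (lebesgue_measure \x lebesgue_tuple R m)%E mphi.
have mA' : measurable (@tuple_cons R m @^-1` A).
  by rewrite -[X in measurable X]setTI; exact: measurable_tuple_cons.
rewrite /= /lebesgue_tuple_succ /pushforward.
rewrite (_ : _ @^-1` (_ @^-1` _) = phi @^-1` (@tuple_cons R m @^-1` A));
  last by apply/seteqP; split=> q /=; rewrite tuple_shift_cons.
rewrite -[LHS]/(nu _); apply/esym/product_measure_unique => //.
move=> X Y mX mY; rewrite /nu /= /pushforward.
rewrite (_ : _ @^-1` _ = ((fun x : mR => x + z ord0 : mR) @^-1` X) `*`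
   (tuple_shift (fun i => z (lift ord0 i)) @^-1` Y))//.
rewrite product_measure1E.
- by congr (_ * _)%E; [exact: lebesgue_measure_shift|exact: IH].
- by rewrite -[X in measurable X]setTI; apply: measurable_funD.
- by rewrite -[X in measurable X]setTI; exact: measurable_tuple_shift.
Qed.

Definition tuple_box (m : nat) (r : R) : set (m.-tuple mR) :=
  [set p | forall i, tnth p i \in `[- r, r]].

Lemma tuple_box_cons (m : nat) (r : R) :
  @tuple_cons R m @^-1` (@tuple_box m.+1 r) =
  [set` `[- r, r]] `*` @tuple_box m r.
Proof.
apply/seteqP; split=> [[x p] /= h|[x p] /= [hx hp] i].
  split; first by have := h ord0; rewrite tnth0.
  by move=> i; have := h (lift ord0 i); rewrite tnthS.
case: (unliftP ord0 i) => [j ->|->]; first by rewrite tnthS; exact: hp.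
by rewrite tnth0.
Qed.

Lemma measurable_tuple_box (m : nat) (r : R) : measurable (@tuple_box m r).
Proof.
rewrite (_ : @tuple_box m r =
    \bigcap_(i in [set: 'I_m]) (fun p => tnth p i) @^-1` [set` `[- r, r]]).
  apply: fin_bigcap_measurable; first exact: finite_finset.
  move=> i _; rewrite -[X in measurable X]setTI.
  by apply: measurable_tnth => //; exact: measurable_itv.
by apply/seteqP; split=> [p h i _|p h i]; [exact: (h i)|exact: (h i I)].
Qed.

Lemma lebesgue_tuple_box (m : nat) (r : R) :
  (lebesgue_tuple R m (@tuple_box m r) < +oo)%E.
Proof.
elim: m => [|m IH]; first by rewrite /= diracE ltry.
rewrite /= /lebesgue_tuple_succ /pushforward tuple_box_cons.
rewrite product_measure1E//; last exact: measurable_tuple_box.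
apply: lte_mul_pinfty => //.
by rewrite -[X in X \is a fin_num]/(lebesgue_measure `[- r, r]%classic)
  lebesgue_measure_itv/=; case: ifPn => //; rewrite -EFinB.
Qed.

End translation.

Section lipschitz.
Context (R : realType) (m : nat).
Local Notation mR := (measurableTypeR R).
Local Notation mu := (lebesgue_tuple R m).

(** The norm is Euclidean, whereas [M.-lipschitz g] refers to the maximum norm
of row vectors. *)
Definition lipschitz (M : R) (g : 'rV[R]_m -> R) : Prop :=
  forall x y, `|g x - g y| <= M * enorm (x - y).

(** A Lipschitz function is the countable infimum of the cones
[g q + M * |p - q|_1] with rational apex [q]; the sum norm keeps each cone
visibly measurable in the coordinates. *)
Lemma measurable_lipschitz (M : R) (g : 'rV[R]_m -> R) : lipschitz M g ->
  measurable_fun setT (fun p : m.-tuple mR => g (row_of_tuple p) : mR).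
Proof.
move=> Mg.
have [M0|M0] := ltP M 0.
  rewrite (_ : (fun p => _) = cst (g 0)); first exact: measurable_cst.
  apply/funext => p; apply/eqP; rewrite -subr_eq0 -normr_le0.
  rewrite (le_trans (Mg _ _))// nmulr_rle0//; exact: enorm_ge0.
pose x_ (q : 'rV[rat]_m) : 'rV[R]_m := map_mx ratr q.
pose cone q (p : m.-tuple mR) : mR :=
  g (x_ q) + M * \sum_(i < m) `|tnth p i - x_ q ord0 i|.
have mcone q : measurable_fun setT (cone q).
  apply: measurable_funD => //; apply: measurable_funM => //.
  apply: measurable_sum => i.
  apply: measurableT_comp => //; apply: measurable_funB => //.
  exact: measurable_tnth.
apply: (measurability _ (RGenInftyO.measurableE R)) => //.
move=> /= _ [_ [c ->] <-]; rewrite setTI.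
rewrite [X in measurable X](_ : _ = \bigcup_q (cone q @^-1` `]-oo, c[)).
  apply: countable_bigcupT_measurable; first exact: countableP.
  move=> q; rewrite -[X in measurable X]setTI.
  by apply: mcone => //; exact: measurable_itv.
apply/seteqP; split=> [p|p [q _]] /=; rewrite !in_itv/=; last first.
  apply: le_lt_trans; rewrite /cone -lerBlDl (le_trans (ler_norm _))//.
  rewrite (le_trans (Mg _ _))// ler_wpM2l// (le_trans (enorm_le_sum _))//.
  by apply: ler_sum => i _; rewrite !mxE.
set x := row_of_tuple p => gxc.
(* The cone at the approximating [q] exceeds [g x] by at most 2 M times the
   sum-norm distance, which [e] makes smaller than [c - g x]. *)
pose e := (c - g x) / ((M + 1) * 2 * m.+1%:R).
have D0 : 0 < (M + 1) * 2 * m.+1%:R by rewrite !mulr_gt0// ltr_wpDl.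
have e0 : 0 < e by rewrite divr_gt0// subr_gt0.
have /choice[q hq] : forall i, exists r : rat, `|x ord0 i - ratr r| < e.
  move=> i; have [r] := rat_in_itvoo (ltr_pwDr e0 (lexx (x ord0 i))).
  rewrite in_itv/= => /andP[h1 h2]; exists r.
  by rewrite distrC ger0_norm; lra.
exists (\row_i q i) => //=; rewrite in_itv/= /cone.
set S := \sum_(i < m) _.
have Se : S <= m%:R * e.
  rewrite mulr_natl -[m in _ *+ m]card_ord -sumr_const.
  by apply: ler_sum => i _; have := hq i; rewrite !mxE => /ltW.
have hg : g (x_ (\row_i q i)) <= g x + M * S.
  rewrite -lerBlDl (le_trans (ler_norm _))// (le_trans (Mg _ _))//.
  rewrite ler_wpM2l// enormBC (le_trans (enorm_le_sum _))//.
  by apply: ler_sum => i _; rewrite !mxE.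
apply: (le_lt_trans (lerD hg (lexx _))).
have : e * ((M + 1) * 2 * m.+1%:R) = c - g x by rewrite divfK// gt_eqF.
have : M * S <= M * (m%:R * e) by rewrite ler_wpM2l.
have : 0 < m.+1%:R :> R by [].
rewrite -natr1; have : 0 <= m%:R :> R by [].
by move: (m%:R) => k; nra.
Qed.

End lipschitz.

(** * Averages over the unit ball *)

Section Rintegral_monotone.
Context d (X : measurableType d) (R : realType) (mu : {measure set X -> \bar R}).

(** The integral of a nonnegative function is a supremum over simple functions
below it, hence monotone on arbitrary functions. In this way a selection of
subgradients is compared with difference quotients. *)
Lemma le_integral_nonmeasurable (D : set X) (f g : X -> \bar R) :
  (forall x, D x -> (f x <= g x)%E) ->
  (\int[mu]_(x in D) f x <= \int[mu]_(x in D) g x)%E.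
Proof.
move=> fg.
have fgD : {in [set: X], forall x, ((f \_ D) x <= (g \_ D) x)%E}.
  by move=> x _; rewrite /patch; case: ifPn => // /[1!inE] /fg.
rewrite /integral; apply: leeB; apply: ereal_sup_le => _ [h hf <-];
  exists h => // x.
  by apply: (le_trans (hf x)); apply: (funepos_le fgD); rewrite inE.
by apply: (le_trans (hf x)); apply: (funeneg_le fgD); rewrite inE.
Qed.

Lemma Rintegral_between (D : set X) (f f1 f2 : X -> R) : measurable D ->
  mu.-integrable D (EFin \o f1) -> mu.-integrable D (EFin \o f2) ->
  (forall x, D x -> f1 x <= f x <= f2 x) ->
  \int[mu]_(x in D) f1 x <= \int[mu]_(x in D) f x <= \int[mu]_(x in D) f2 x.
Proof.
move=> mD if1 if2 ff.
have h1 : (\int[mu]_(x in D) (f1 x)%:E <= \int[mu]_(x in D) (f x)%:E)%E.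
  by apply: le_integral_nonmeasurable => x /ff/andP[]; rewrite lee_fin.
have h2 : (\int[mu]_(x in D) (f x)%:E <= \int[mu]_(x in D) (f2 x)%:E)%E.
  by apply: le_integral_nonmeasurable => x /ff/andP[]; rewrite lee_fin.
have F1 := integrable_fin_num mD if1; have F2 := integrable_fin_num mD if2.
have F : (\int[mu]_(x in D) (f x)%:E)%E \is a fin_num.
  rewrite fin_numElt (lt_le_trans _ h1) ?(le_lt_trans h2)//.
    by move: F2; rewrite fin_numElt => /andP[].
  by move: F1; rewrite fin_numElt => /andP[].
by rewrite /Rintegral !fine_le.
Qed.

End Rintegral_monotone.

Section ball_average.
Context (R : realType) (m : nat).
Local Notation mR := (measurableTypeR R).
Local Notation mu := (lebesgue_tuple R m).
Local Notation row := (@row_of_tuple R m).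

Definition tuple_ball (r : R) : set (m.-tuple mR) := row @^-1` eball 0 r.

Lemma lipschitz_enorm : lipschitz 1 (@enorm R m).
Proof. by move=> x y; rewrite mul1r ler_dist_enorm. Qed.

Lemma measurable_tuple_ball r : measurable (tuple_ball r).
Proof.
rewrite (_ : tuple_ball r = (fun p => enorm (row p) : mR) @^-1` `]-oo, r]).
  rewrite -[X in measurable X]setTI.
  by apply: (measurable_lipschitz lipschitz_enorm) => //; exact: measurable_itv.
by apply/seteqP; split => p; rewrite /tuple_ball /eball/= subr0 in_itv.
Qed.
Hint Resolve measurable_tuple_ball : core.

Lemma tuple_ball_lty r : (mu (tuple_ball r) < +oo)%E.
Proof.
apply: le_lt_trans (lebesgue_tuple_box m r); apply: le_measure; rewrite ?inE//.
  exact: measurable_tuple_box.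
move=> p; rewrite /tuple_ball /eball /= subr0 => pr i.
rewrite in_itv/= -ler_norml (le_trans _ pr)//.
by have := le_coord_enorm (row p) i; rewrite mxE.
Qed.

Definition tuple_annulus r : set (m.-tuple mR) :=
  tuple_ball (1 + r) `\` tuple_ball 1.

Lemma measurable_tuple_annulus r : measurable (tuple_annulus r).
Proof. exact: measurableD. Qed.
Hint Resolve measurable_tuple_annulus : core.

Lemma tuple_annulus_lty r : (mu (tuple_annulus r) < +oo)%E.
Proof.
apply: le_lt_trans (tuple_ball_lty (1 + r)); apply: le_measure; rewrite ?inE//.
exact: subDsetl.
Qed.

(** The annuli are nested and have empty intersection, since the inner ball is
closed. *)
Lemma small_tuple_annulus (e : R) : 0 < e ->
  exists2 r, 0 < r & fine (mu (tuple_annulus r)) <= e.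
Proof.
move=> e0.
pose F k := tuple_annulus k.+1%:R^-1.
have F0 : \bigcap_k F k = set0.
  apply/seteqP; split=> // p Fp.
  have [_] := Fp 0%N I; rewrite /tuple_ball /eball/= subr0 => /negP.
  rewrite -ltNge => p1.
  have p10 : 0 < enorm (row p) - 1 by rewrite subr_gt0.
  have [k _ /(_ k (leqnn k))] := near_infty_natSinv_lt (PosNum p10).
  rewrite /= ltrBrDl ltNge => /negP; apply.
  by have [+ _] := Fp k I; rewrite /tuple_ball /eball/= subr0.
have : mu (F k) @[k --> \oo] --> mu (\bigcap_k F k).
  apply: nonincreasing_cvg_mu.
  - exact: tuple_annulus_lty.
  - by move=> k; exact: measurable_tuple_annulus.
  - by rewrite F0.
  move=> k l kl; apply/subsetPset => p [pl p1]; split => //.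
  move: pl; rewrite /tuple_ball /eball/= => /le_trans; apply.
  by rewrite lerD2l lef_pV2 ?posrE// ler_nat ltnS.
rewrite F0 measure0 => /fine_cvg/cvgrPdist_le/(_ _ e0)[k _ /(_ k (leqnn k))].
rewrite /= sub0r normrN => h; exists k.+1%:R^-1; first by rewrite invr_gt0.
exact: le_trans (ler_norm _) h.
Qed.

Lemma integrable_bounded_lipschitz (M c : R) (A : set (m.-tuple mR))
    (f : 'rV[R]_m -> R) : measurable A -> (mu A < +oo)%E -> lipschitz M f ->
  (forall p, A p -> `|f (row p)| <= c) ->
  mu.-integrable A (EFin \o (fun p => f (row p))).
Proof.
move=> mA Aoo Mf fc; apply: measurable_bounded_integrable => //.
  by apply: measurable_funTS; exact: measurable_lipschitz Mf.
exists c; split; first by rewrite num_real.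
by move=> x cx p Ap /=; rewrite (le_trans (fc _ Ap))// ltW.
Qed.

Lemma le_normr_integral_bounded (M c : R) (A C : set (m.-tuple mR))
    (f : 'rV[R]_m -> R) : measurable A -> measurable C -> (mu C < +oo)%E ->
  (mu A <= mu C)%E -> lipschitz M f -> (forall x, `|f x| <= c) ->
  `|\int[mu]_(p in A) f (row p)| <= c * fine (mu C).
Proof.
move=> mA mC Coo AC Mf fc.
have Aoo : (mu A < +oo)%E by exact: le_lt_trans Coo.
have c0 : 0 <= c by rewrite (le_trans _ (fc 0)).
apply: (le_trans (le_normr_Rintegral mA _)).
  exact: integrable_bounded_lipschitz Mf _.
apply: (@le_trans _ _ (\int[mu]_(p in A) c)).
  apply: le_Rintegral => //.
  - apply: (@integrable_bounded_lipschitz M c _ (fun x => `|f x|)) => //.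
      by move=> x y; rewrite (le_trans (ler_dist_dist _ _)).
    by move=> p _; rewrite normr_id.
  - apply: (@integrable_bounded_lipschitz 0 c _ (fun=> c)) => //.
      by move=> x y; rewrite subrr normr0 mul0r.
    by move=> p _; rewrite ger0_norm.
rewrite Rintegral_cst// ler_wpM2l// fine_le// ge0_fin_numE//.
Qed.

Definition shifted_integral (f : 'rV[R]_m -> R) (z : 'rV[R]_m) : R :=
  \int[mu]_(p in @unit_ball R m) f (row p + z).

Lemma lipschitz_shift (M : R) f (z : 'rV[R]_m) :
  lipschitz M f -> lipschitz M (fun x => f (x + z)).
Proof.
by move=> Mf x y; rewrite (le_trans (Mf _ _))// opprD addrACA subrr addr0.
Qed.

(** Shifting the integrand amounts to shifting the ball, and a shift of length
at most [r] changes the ball inside an annulus of width [r] only; by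
translation invariance this also holds for the part of the ball that is left
uncovered. *)
Lemma shifted_integral_near (M c r : R) (f : 'rV[R]_m -> R) (z : 'rV[R]_m) :
  lipschitz M f -> (forall x, `|f x| <= c) -> enorm z <= r ->
  `|shifted_integral f z - shifted_integral f 0| <=
    2 * c * fine (mu (tuple_annulus r)).
Proof.
move=> Mf fc zr.
pose phi := tuple_shift (z ord0).
have mphi : measurable_fun setT phi by exact: measurable_tuple_shift.
pose B := tuple_ball 1; pose B' := tuple_shift ((- z) ord0) @^-1` B.
have rowB' p : B' p <-> enorm (row p - z) <= 1.
  by rewrite /B' /B /tuple_ball /eball/= row_of_tuple_shift subr0.
have rowB p : B p <-> enorm (row p) <= 1.
  by rewrite /B /tuple_ball /eball/= subr0.
have mB : measurable B by exact: measurable_tuple_ball.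
have mB' : measurable B'.
  by rewrite -[X in measurable X]setTI; exact: measurable_tuple_shift.
have phiB' : phi @^-1` B' = B.
  apply/seteqP; split=> p; rewrite [X in X -> _]/= => /=.
    by move=> /rowB'; rewrite row_of_tuple_shift addrK => /rowB.
  by move=> /rowB h; apply/rowB'; rewrite row_of_tuple_shift addrK.
have muB' : mu B' = mu B by exact: lebesgue_tuple_shift.
have Boo : (mu B < +oo)%E by exact: tuple_ball_lty.
have -> : shifted_integral f z = \int[mu]_(p in B') f (row p).
  pose nu : {measure set (m.-tuple mR) -> \bar R} :=
    measure_function_pushforward__canonical__measure_function_Measure mu mphi.
  rewrite /Rintegral.
  have -> : (\int[mu]_(p in B') (f (row p))%:E =
             \int[nu]_(p in B') (f (row p))%:E)%E.
    by apply: eq_measure_integral => A mA _; exact/esym/lebesgue_tuple_shift.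
  rewrite [X in fine X](integral_pushforward mphi)//.
  - rewrite phiB'; congr fine; apply: eq_integral => p _ /=.
    by rewrite row_of_tuple_shift.
  - by apply/measurable_EFinP; exact: measurable_lipschitz Mf.
  - rewrite phiB'.
    rewrite (_ : _ \o _ = EFin \o (fun p => f (row p + z))); last first.
      by apply/funext => p /=; rewrite row_of_tuple_shift.
    apply: (@integrable_bounded_lipschitz M c _ (fun x => f (x + z))) => //.
    exact: lipschitz_shift.
have -> : shifted_integral f 0 = \int[mu]_(p in B) f (row p).
  by rewrite /shifted_integral; under eq_Rintegral do rewrite addr0.
have split_int (X Y : set (m.-tuple mR)) : measurable X -> measurable Y ->
    (mu X < +oo)%E -> \int[mu]_(p in X) f (row p) =
    \int[mu]_(p in X `&` Y) f (row p) + \int[mu]_(p in X `\` Y) f (row p).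
  move=> mX mY Xoo; rewrite -Rintegral_setU ?setUIDK//.
  - exact: measurableI.
  - exact: measurableD.
  - exact: integrable_bounded_lipschitz Mf _.
  - by apply/disj_setPS => p [[_ ?] [_ ?]].
rewrite (split_int B' B)// ?muB'// (split_int B B')// (setIC B B').
rewrite opprD addrACA subrr add0r (le_trans (ler_normB _ _))//.
have inA p : enorm (row p + z) <= 1 \/ enorm (row p - z) <= 1 ->
    ~ B p -> tuple_annulus r p.
  move=> h nBp; split => //; rewrite /tuple_ball /eball/= subr0.
  case: h => h.
    by have := ler_enormD (row p + z) (- z); rewrite addrK enormN; lra.
  by have := ler_enormD (row p - z) z; rewrite subrK; lra.
have mBB' : measurable (B `\` B') by exact: measurableD.
rewrite -mulrA mulr_natl mulr2n lerD//.
  apply: (le_normr_integral_bounded _ _ (tuple_annulus_lty r)) Mf fc => //.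
    exact: measurableD.
  apply: le_measure; rewrite ?inE//; first exact: measurableD.
  by move=> p [/rowB' hp nBp]; apply: inA => //; right.
apply: (le_normr_integral_bounded _ _ (tuple_annulus_lty r)) Mf fc => //.
rewrite -(lebesgue_tuple_shift (z ord0))//.
apply: le_measure; rewrite ?inE//.
  by rewrite -[X in measurable X]setTI; exact: measurable_tuple_shift.
move=> p [/rowB]; rewrite row_of_tuple_shift => hp nBp.
apply: inA; first by left.
by move=> /rowB h; apply: nBp; apply/rowB'; rewrite row_of_tuple_shift addrK.
Qed.

End ball_average.

(** * Subgradient averages *)

Section subgradient_average.
Context (R : realType) (m : nat).
Local Notation mR := (measurableTypeR R).
Local Notation mu := (lebesgue_tuple R m).
Local Notation row := (@row_of_tuple R m).
Local Notation B := (@unit_ball R m).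
Local Notation vol := (fine (mu B)).
Local Notation annulus r := (fine (mu (tuple_annulus r))).
Implicit Types (f g : 'rV[R]_m -> R) (u z w : 'rV[R]_m) (v : m.-tuple mR -> R).

Lemma vol_ge0 : 0 <= vol.
Proof. exact: fine_ge0. Qed.

Lemma measurable_unit_ball : measurable B.
Proof. exact: measurable_tuple_ball. Qed.

Lemma unit_ball_lty : (mu B < +oo)%E.
Proof. exact: tuple_ball_lty. Qed.

Lemma unit_ballP p : B p -> enorm (row p) <= 1.
Proof. by rewrite /unit_ball /eball/= subr0. Qed.

Lemma integrable_shift M f z : lipschitz M f ->
  mu.-integrable B (EFin \o (fun p => f (row p + z))).
Proof.
move=> Mf.
have M0 : 0 <= `|M| * (1 + enorm z) by rewrite mulr_ge0// addr_ge0// enorm_ge0.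
apply: (@integrable_bounded_lipschitz _ _ M (`|f 0| + `|M| * (1 + enorm z)) _
  (fun x => f (x + z))).
- exact: measurable_unit_ball.
- exact: unit_ball_lty.
- exact: lipschitz_shift.
move=> p /unit_ballP p1; rewrite -[f (_ + _)](subrK (f 0)) addrC.
rewrite (le_trans (ler_normD _ _))// lerD2l (le_trans (Mf _ _))// subr0.
rewrite (le_trans (ler_wpM2r (enorm_ge0 _) (ler_norm M)))// ler_wpM2l//.
by rewrite (le_trans (ler_enormD _ _))// lerD2r.
Qed.

Lemma shifted_integral_le M1 M2 f g c z w : lipschitz M1 f -> lipschitz M2 g ->
  (forall p, B p -> f (row p + z) <= g (row p + w) + c) ->
  shifted_integral f z <= shifted_integral g w + vol * c.
Proof.
move=> Mf Mg fg; rewrite mulrC -Rintegral_cst; last exact: measurable_unit_ball.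
have mB := measurable_unit_ball.
have Lc : mu.-integrable B (EFin \o (fun=> c)).
  apply: (@integrable_shift 0 (fun=> c) 0).
  by move=> x y; rewrite subrr normr0 mul0r.
rewrite /shifted_integral -RintegralD//; last exact: integrable_shift Mg.
apply: le_Rintegral => //; first exact: integrable_shift Mf.
have Lgc : lipschitz M2 (fun x => g x + c).
  by move=> x y; rewrite opprD addrACA subrr addr0.
exact: integrable_shift Lgc.
Qed.

(** The mixed second difference of the smoothed function is of smaller order
than the shifts, since it compares the averages of [f (x + w) - f x] over the
ball and over the shifted ball. *)
Lemma shifted_integral_second_difference M r f z w : 0 <= M -> lipschitz M f ->
  enorm z <= r ->
  `|shifted_integral f (z + w) - shifted_integral f z -
    (shifted_integral f w - shifted_integral f 0)| <=
  2 * (M * enorm w) * annulus r.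
Proof.
move=> M0 Mf zr; pose g x := f (x + w) - f x.
have Mw : lipschitz M (fun x => f (x + w)) by exact: lipschitz_shift.
have Mg : lipschitz (M + M) g.
  move=> x y; have -> : g x - g y = f (x + w) - f (y + w) - (f x - f y).
    by rewrite /g; ring.
  by rewrite (le_trans (ler_normB _ _))// mulrDl lerD//; exact: Mw.
have gc x : `|g x| <= M * enorm w.
  by rewrite (le_trans (Mf _ _))// addrAC subrr add0r.
have gE x : shifted_integral g x =
    shifted_integral f (x + w) - shifted_integral f x.
  rewrite /shifted_integral -RintegralB; last 3 first.
  - exact: measurable_unit_ball.
  - exact: integrable_shift Mf.
  - exact: integrable_shift Mf.
  by apply: eq_Rintegral => p _; rewrite /g addrA.
by have := shifted_integral_near Mg gc zr; rewrite !gE add0r.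
Qed.

(** For convex [f], [v p] is a subderivative at [0] of [h |-> f (p + h u)]. Since
[h] may be negative, [v p] lies between the two one-sided derivatives. *)
Definition directional_subgradient f u v : Prop :=
  forall p h, B p -> h * v p <= f (row p + h *: u) - f (row p).

(** Dividing the pointwise inequality by [h] first bounds [v] by a measurable
function, from above or from below according to the sign of [h]; only the
monotonicity of the integral is then used for [v] itself. *)
Lemma le_average_subgradient M f u v h : 0 <= M -> lipschitz M f ->
  directional_subgradient f u v ->
  h * \int[mu]_(p in B) v p <= shifted_integral f (h *: u) - shifted_integral f 0.
Proof.
move=> M0 Mf fuv.
pose q h p := h^-1 * (f (row p + h *: u) - f (row p)).
have mB := measurable_unit_ball.
have f0 : lipschitz M (fun x => f (x + 0)) by exact: lipschitz_shift.
have id k : mu.-integrable B (EFin \o (fun p => f (row p + k *: u) - f (row p))).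
  have := integrableB mB (integrable_shift (k *: u) Mf) (integrable_shift 0 Mf).
  by apply: eq_integrable => // p _ /=; rewrite addr0.
have iq k : mu.-integrable B (EFin \o q k).
  have := integrableZl mB k^-1 (id k); apply: eq_integrable => //.
have q_le k p : 0 < k -> B p -> v p <= q k p.
  by move=> k0 Bp; rewrite /q mulrC ler_pdivlMr// mulrC fuv.
have q_ge k p : k < 0 -> B p -> q k p <= v p.
  by move=> k0 Bp; rewrite /q mulrC ler_ndivrMr// mulrC fuv.
have dE k : \int[mu]_(p in B) (f (row p + k *: u) - f (row p)) =
    shifted_integral f (k *: u) - shifted_integral f 0.
  rewrite /shifted_integral -RintegralB//; [|exact: integrable_shift Mf..].
  by apply: eq_Rintegral => p _; rewrite addr0.
have qE k : k != 0 -> k * \int[mu]_(p in B) q k p =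
    shifted_integral f (k *: u) - shifted_integral f 0.
  by move=> k0; rewrite RintegralZl// mulrA divff// mul1r dE.
have [->|h0] := eqVneq h 0; first by rewrite mul0r scale0r subrr.
have := h0; rewrite neq_lt => /orP[hn|hp].
  have /andP[+ _] : \int[mu]_(p in B) q h p <= \int[mu]_(p in B) v p
      <= \int[mu]_(p in B) q 1 p.
    by apply: Rintegral_between => // p Bp; rewrite q_ge// q_le.
  by rewrite -(ler_nM2l hn) qE.
have /andP[_ +] : \int[mu]_(p in B) q (-1) p <= \int[mu]_(p in B) v p
    <= \int[mu]_(p in B) q h p.
  by apply: Rintegral_between => // p Bp; rewrite q_ge ?q_le ?oppr_lt0.
by rewrite -(ler_pM2l hp) qE.
Qed.

(** For a fixed small step [h] an average subgradient is, up to an error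
controlled by the second difference, the difference quotient of the smoothed
function, which depends continuously on the function. *)
Lemma average_subgradient_continuous M e : 0 <= M -> 0 < e ->
  exists2 d, 0 < d & forall f1 f2 u v1 v2,
    lipschitz M f1 -> lipschitz M f2 -> enorm u = 1 ->
    directional_subgradient f1 u v1 -> directional_subgradient f2 u v2 ->
    (forall x, enorm x <= 2 -> `|f1 x - f2 x| <= d) ->
    \int[mu]_(p in B) v1 p - \int[mu]_(p in B) v2 p <= e.
Proof.
move=> M0 e0.
have Me : 0 < e / (4 * (M + 1)) by rewrite divr_gt0// mulr_gt0// ltr_wpDl.
have [r r0 ar] := small_tuple_annulus m Me.
pose h := Num.min r 1.
have h0 : 0 < h by rewrite lt_min r0 ltr01.
have hr : h <= r by rewrite ge_min lexx.
have h1 : h <= 1 by rewrite ge_min lexx orbT.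
have V0 := vol_ge0.
have d0 : 0 < e * h / (4 * (vol + 1)).
  by rewrite divr_gt0// mulr_gt0// ltr_wpDl.
exists (e * h / (4 * (vol + 1))) => //; set d := _ / _.
move=> f1 f2 u v1 v2 Mf1 Mf2 u1 fv1 fv2 f12.
have le1 := le_average_subgradient h M0 Mf1 fv1.
have le2 := le_average_subgradient (- h) M0 Mf2 fv2.
have hu : enorm (h *: u) = h by rewrite enormZ u1 mulr1 ger0_norm// ltW.
have Bh p : B p -> enorm (row p + h *: u) <= 2.
  move=> /unit_ballP p1; rewrite (le_trans (ler_enormD _ _))// hu.
  by rewrite (natrD _ 1 1) lerD.
have B0 p : B p -> enorm (row p + 0) <= 2.
  by move=> /unit_ballP p1; rewrite addr0 (le_trans p1)// ler1n.
have c1 : shifted_integral f1 (h *: u) <= shifted_integral f2 (h *: u) + vol * d.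
  apply: shifted_integral_le Mf1 Mf2 _ => p /Bh /f12.
  by rewrite ler_norml => /andP[_]; rewrite lerBlDl addrC.
have c2 : shifted_integral f2 0 <= shifted_integral f1 0 + vol * d.
  apply: shifted_integral_le Mf2 Mf1 _ => p /B0 /f12.
  by rewrite ler_norml => /andP[+ _]; lra.
have hur : enorm (h *: u) <= r by rewrite hu.
have := shifted_integral_second_difference (- h *: u) M0 Mf2 hur.
rewrite scaleNr enormN subrr hu ler_norml => /andP[+ _].
rewrite scaleNr in le2.
have vd : 4 * (vol * d) <= e * h.
  have : d * (4 * (vol + 1)) = e * h.
    by rewrite divfK// gt_eqF// mulr_gt0// ltr_wpDl.
  by move: d0; rewrite -/d; nra.
have Ma : 4 * (M * annulus r) <= e.
  have a0 : 0 <= annulus r by exact: fine_ge0.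
  move: ar; rewrite ler_pdivlMr; last by rewrite mulr_gt0// ltr_wpDl.
  by nra.
have hMa : h * (4 * (M * annulus r)) <= h * e by rewrite ler_wpM2l// ltW.
move=> hd; rewrite -(ler_pM2l h0); nra.
Qed.



(** Increments of the smoothed function along small steps add up, because a
mixed second difference is of smaller order than the steps. *)
Lemma shifted_integral_sum M r f (a : 'I_m -> 'rV[R]_m) (s : seq 'I_m) :
  0 <= M -> lipschitz M f -> \sum_(j <- s) enorm (a j) <= r ->
  \sum_(j <- s) (shifted_integral f (a j) - shifted_integral f 0) <=
  shifted_integral f (\sum_(j <- s) a j) - shifted_integral f 0 +
  2 * (M * \sum_(j <- s) enorm (a j)) * annulus r.
Proof.
move=> M0 Mf; elim: s => [|j s IH]; first by rewrite !big_nil subrr !mulr0 mul0r addr0.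
rewrite !big_cons => jr.
have sr : \sum_(i <- s) enorm (a i) <= r.
  by apply: le_trans jr; rewrite lerDr enorm_ge0.
have := shifted_integral_second_difference (a j) M0 Mf
  (le_trans (ler_enorm_sum _ _ _) sr).
rewrite (addrC (\sum_(i <- s) a i)) ler_norml => /andP[+ _].
by have := IH sr; nra.
Qed.

(** The derivative of the smoothed function in the direction [u] is the
combination of its partial derivatives, which are the averages of the [v j];
it is at most [vol * C] since [f] grows with slope at most [C] along [u]. *)
Lemma average_subgradient_le M f (v : 'I_m -> m.-tuple mR -> R) u C :
  0 <= M -> lipschitz M f ->
  (forall j, directional_subgradient f (delta_mx ord0 j) (v j)) ->
  (forall x h, 0 <= h -> f (x + h *: u) <= f x + h * C) ->
  \sum_j u ord0 j * \int[mu]_(p in B) v j p <= vol * C.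
Proof.
move=> M0 Mf fv fu; apply/ler_addgt0Pr => e e0.
pose S := \sum_j `|u ord0 j|.
have S0 : 0 <= S by exact: sumr_ge0.
have MS : 0 < 2 * (M * S) + 1 by rewrite ltr_wpDl// !mulr_ge0.
have [r r0 ar] := small_tuple_annulus m (divr_gt0 e0 MS).
pose h := r / (S + 1).
have h0 : 0 < h by rewrite divr_gt0// ltr_wpDl.
pose a j := (h * u ord0 j) *: (delta_mx ord0 j : 'rV[R]_m).
have aS : \sum_j enorm (a j) = h * S.
  rewrite mulr_sumr; apply: eq_bigr => j _.
  by rewrite enormZ enorm_delta mulr1 normrM gtr0_norm.
have hSr : h * S <= r.
  by rewrite /h mulrAC ler_pdivrMr ?ltr_wpDl// ler_wpM2l ?(ltW r0)// lerDl.
have asum : \sum_j a j = h *: u.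
  rewrite [in RHS](row_sum_delta u) scaler_sumr.
  by apply: eq_bigr => j _; rewrite scalerA.
have := @shifted_integral_sum M r f a (index_enum _) M0 Mf.
rewrite aS asum => /(_ hSr) sum_le.
have hsum : h * (\sum_j u ord0 j * \int[mu]_(p in B) v j p) <=
    \sum_j (shifted_integral f (a j) - shifted_integral f 0).
  rewrite mulr_sumr; apply: ler_sum => j _; rewrite mulrA.
  exact: (le_average_subgradient _ M0 Mf (fv j)).
have hC : shifted_integral f (h *: u) <= shifted_integral f 0 + vol * (h * C).
  apply: (shifted_integral_le Mf Mf) => p _; rewrite addr0.
  by rewrite fu// ltW.
have a0 : 0 <= annulus r by exact: fine_ge0.
have Ma : 2 * (M * S) * annulus r <= e.
  by move: ar; rewrite ler_pdivlMr//; nra.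
have hMa : h * (2 * (M * S) * annulus r) <= h * e by rewrite ler_wpM2l// ltW.
rewrite -(ler_pM2l h0); nra.
Qed.

End subgradient_average.

(** * Steiner points *)

Section steiner_point.
Context (R : realType) (m : nat).
Local Notation mR := (measurableTypeR R).
Local Notation mu := (lebesgue_tuple R m).
Local Notation row := (@row_of_tuple R m).
Local Notation B := (@unit_ball R m).
Local Notation vol := (fine (mu B)).
Implicit Types (K : set 'rV[R]_m) (p x u : 'rV[R]_m).

Lemma le_support_fun K M p x : K `<=` eball 0 M -> K x ->
  dot p x <= support_fun K p.
Proof.
move=> KM Kx; apply: ub_le_sup; last by exists x.
exists (enorm p * M) => _ [y /KM + <-]; rewrite /eball/= subr0 => yM.
by rewrite (le_trans (dot_le_enorm _ _))// ler_wpM2l// enorm_ge0.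
Qed.

Lemma support_fun_le K C p : K !=set0 ->
  (forall x, K x -> dot p x <= C) -> support_fun K p <= C.
Proof.
move=> [x Kx] KC; apply: ge_sup; first by exists (dot p x), x.
by move=> _ [y Ky <-]; exact: KC.
Qed.

Lemma support_fun_lipschitz K M : K !=set0 -> K `<=` eball 0 M ->
  lipschitz M (support_fun K).
Proof.
move=> K0 KM.
have le p q : support_fun K p <= support_fun K q + M * enorm (p - q).
  apply: support_fun_le => // x Kx; rewrite -(subrK q p) dotDl addrC lerD//.
    exact: le_support_fun KM Kx.
  rewrite addrK (le_trans (dot_le_enorm _ _))// mulrC ler_wpM2r ?enorm_ge0//.
  by have := KM _ Kx; rewrite /eball/= subr0.
move=> p q; rewrite ler_distlC; apply/andP; split.
  by rewrite lerBlDr; exact: le.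
by rewrite enormBC; exact: le.
Qed.

Lemma support_fun_max K p : K !=set0 -> compact K ->
  exists2 x, K x & support_fun K p = dot p x.
Proof.
move=> K0 cK.
have [|x] := @compact_EVT_max _ _ (dot p) K K0 cK.
  by apply: continuous_subspaceT; exact: dot_continuous.
rewrite inE => Kx xmax; exists x => //; apply/eqP; rewrite eq_le.
rewrite support_fun_le//=; last by move=> y Ky; apply: xmax; rewrite inE.
apply: ub_le_sup; last by exists x.
by exists (dot p x) => _ [y Ky <-]; apply: xmax; rewrite inE.
Qed.

Lemma closed_subdifferential (g : 'rV[R]_m -> R) p : closed (subdifferential g p).
Proof.
rewrite (_ : subdifferential g p =
    \bigcap_q ((dot (q - p)) @^-1` [set s | s <= g q - g p])).
  apply: closed_bigI => q _; apply: preimage_closed; last exact: closed_le.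
  by move=> x _; exact: dot_continuous.
by apply/seteqP; split=> [x h q _|x h q]; [have := h q|have := h q I];
  rewrite /= (dotC (q - p)) lerBrDl.
Qed.

Lemma min_norm_eltP (A : set 'rV[R]_m) : closed A -> A !=set0 ->
  A (min_norm_elt A).
Proof.
move=> cA [x0 Ax0]; rewrite /min_norm_elt.
have [|||x] := @compact_EVT_min _ _ (@enorm R m) (A `&` eball 0 (enorm x0)).
- by exists x0; split; rewrite /eball//= subr0.
- exact: closed_eball_compact.
- by apply: continuous_subspaceT; exact: enorm_continuous.
rewrite inE => -[Ax]; rewrite /eball/= subr0 => xx0 xmin.
apply: (@proj1 _ (forall y, A y -> enorm (min_norm_elt A) <= enorm y)).
apply: (@xgetPex _ 0 [set x | A x /\ forall y, A y -> enorm x <= enorm y]).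
exists x; split => // y Ay.
have [yx0|/ltW] := leP (enorm y) (enorm x0); last exact: le_trans.
by apply: xmin; rewrite inE; split; rewrite /eball//= subr0.
Qed.

(** The set of subgradients is closed, and it contains the points of [K] at which
[dot p] is maximal; so there is one of least norm. *)
Lemma min_norm_subgradient K p : K !=set0 -> compact K ->
  subdifferential (support_fun K) p
    (min_norm_elt (subdifferential (support_fun K) p)).
Proof.
move=> K0 cK; apply: min_norm_eltP; first exact: closed_subdifferential.
have [x Kx pE] := support_fun_max p K0 cK; exists x => q.
have [y Ky qE] := support_fun_max q K0 cK.
rewrite pE dotBr !(dotC x) addrC subrK.
apply: ub_le_sup; last by exists x.
exists (dot q y) => _ [z Kz <-]; rewrite -qE.
have /compact_bounded[M [_ KM]] := cK.
apply: (@le_support_fun K (m%:R * (M + 1))) => // w Kw.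
rewrite /eball/= subr0 (le_trans (enorm_le_norm _))// ler_wpM2l//.
by apply: KM => //; rewrite ltrDl.
Qed.

Definition min_norm_coord K (j : 'I_m) (p : m.-tuple mR) : R :=
  min_norm_elt (subdifferential (support_fun K) (row p)) ord0 j.

Lemma min_norm_directional K j : K !=set0 -> compact K ->
  directional_subgradient (support_fun K) (delta_mx ord0 j) (min_norm_coord K j).
Proof.
move=> K0 cK p h _.
have := min_norm_subgradient (row p) K0 cK.
move=> /(_ (row p + h *: delta_mx ord0 j)).
by rewrite (addrC (row p)) addrK dotZr dot_delta lerBrDl.
Qed.

Lemma steinerE K j : steiner K ord0 j =
  vol^-1 * \int[mu]_(p in B) min_norm_coord K j p.
Proof. by rewrite mxE. Qed.

(** Each coordinate of a Steiner point is an average subgradient of the support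
function in a coordinate direction. *)
Lemma steiner_continuous M e : 0 <= M -> 0 < e ->
  exists2 d, 0 < d & forall K1 K2, K1 !=set0 -> K2 !=set0 ->
    compact K1 -> compact K2 -> K1 `<=` eball 0 M -> K2 `<=` eball 0 M ->
    (forall x, enorm x <= 2 -> `|support_fun K1 x - support_fun K2 x| <= d) ->
    enorm (steiner K1 - steiner K2) <= e.
Proof.
move=> M0 e0.
have V0 : 0 <= vol^-1 by rewrite invr_ge0 vol_ge0.
have V1 : 0 < vol^-1 + 1 by rewrite ltr_wpDl.
pose e' := e / (m.+1%:R * (vol^-1 + 1)).
have e'0 : 0 < e' by rewrite divr_gt0// mulr_gt0.
have [d d0 dP] := average_subgradient_continuous m M0 e'0.
exists d => // K1 K2 K10 K20 cK1 cK2 K1M K2M K12.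
have L1 := support_fun_lipschitz K10 K1M.
have L2 := support_fun_lipschitz K20 K2M.
rewrite (le_trans (enorm_le_sum _))//.
have coord j : `|(steiner K1 - steiner K2) ord0 j| <= e / m.+1%:R.
  have D1 := min_norm_directional j K10 cK1.
  have D2 := min_norm_directional j K20 cK2.
  have u1 := @enorm_delta R m j.
  rewrite mxE [X in _ + X]mxE !steinerE -mulrBr normrM (ger0_norm V0).
  have K21 x : enorm x <= 2 -> `|support_fun K2 x - support_fun K1 x| <= d.
    by rewrite distrC; exact: K12.
  rewrite (@le_trans _ _ ((vol^-1 + 1) * e'))//.
    apply: ler_pM => //; first by rewrite lerDl.
    rewrite ler_norml (dP _ _ _ _ _ L1 L2 u1 D1 D2 K12) andbT.
    by rewrite lerNl opprB (dP _ _ _ _ _ L2 L1 u1 D2 D1 K21).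
  by rewrite /e' invfM mulrCA (mulrCA (_ + _)) divff ?gt_eqF// mulr1.
rewrite (@le_trans _ _ (\sum_(j < m) (e / m.+1%:R)))//; first exact: ler_sum.
rewrite sumr_const card_ord -[_ *+ m]mulr_natl mulrA ler_pdivrMr// mulrC.
by rewrite ler_wpM2l ?ler_nat// ltW.
Qed.

(** Testing with a vector [u] that depends on the Steiner point itself, this
confines projections of the Steiner point to balls that contain the
projections of [K]. *)
Lemma steiner_halfspace K u C : 0 <= C -> K !=set0 -> compact K ->
  (forall x, K x -> dot x u <= C) -> dot (steiner K) u <= C.
Proof.
move=> C0 K0 cK KC.
have /compact_bounded[M' [_ KM']] := cK.
pose M := m%:R * `|M' + 1|.
have M0 : 0 <= M by rewrite mulr_ge0.
have KM : K `<=` eball 0 M.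
  move=> w Kw; rewrite /eball/= subr0 (le_trans (enorm_le_norm _))//.
  rewrite ler_wpM2l// (le_trans _ (ler_norm _))//.
  by apply: KM' => //; rewrite ltrDl.
have L := support_fun_lipschitz K0 KM.
have := @average_subgradient_le _ _ M _ (min_norm_coord K) u C M0 L.
have fu x h : 0 <= h -> support_fun K (x + h *: u) <= support_fun K x + h * C.
  move=> h0; apply: support_fun_le => // y Ky; rewrite dotDl dotZl lerD//.
    exact: le_support_fun KM Ky.
  by rewrite ler_wpM2l// dotC KC.
move=> /(_ (fun j => min_norm_directional j K0 cK) fu) sum_le.
rewrite /dot; under eq_bigr do rewrite steinerE -mulrA (mulrC _ (u _ _)).
rewrite -mulr_sumr.
have V0 : 0 <= vol^-1 by rewrite invr_ge0 vol_ge0.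
rewrite (le_trans (ler_wpM2l V0 sum_le))// mulrA.
have [->|v0] := eqVneq vol 0; first by rewrite mulr0 mul0r.
by rewrite mulVf// mul1r.
Qed.

End steiner_point.

(** * Truncations of converging convex sets *)

Lemma compact_near (X : topologicalType) (I : Type) (F : set_system I)
    (FF : Filter F) (K : set X) (P : I -> X -> Prop) : compact K ->
  (forall x, K x -> \forall x' \near x & i \near F, P i x') ->
  \forall i \near F, forall x, K x -> P i x.
Proof. by move=> /compact_near_coveringP cK; exact: cK. Qed.

Section truncation.
Local Notation edist := Defs.edist.
Context (R : realType) (m : nat).
Implicit Types (E K : set 'rV[R]_m) (a z : 'rV[R]_m).

Lemma closed_enormP E a : closed E ->
  (forall e : R, 0 < e -> exists2 z, E z & enorm (z - a) < e) -> E a.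
Proof.
move=> cE Ea; apply: cE => U /nbhs_ballP[e /= e0 aU].
have [z Ez za] := Ea e e0; exists z; split => //; apply: aU.
rewrite mx_norm_ball /ball_/= (le_lt_trans (norm_le_enorm _))//.
by rewrite enormBC.
Qed.

Lemma convex_setP E : convex_set E <-> forall x y (t : R), E x -> E y ->
  0 <= t <= 1 -> E (x + t *: (y - x)).
Proof.
split=> [vE x y t Ex Ey /andP[t0 t1]|vE x y t /[!inE] Ex Ey].
  have := vE y x (Itv01 t0 t1); rewrite !inE => /(_ Ey Ex).
  by congr E; rewrite /conv/= /unstable.onem; apply/rowP => i; rewrite !mxE; ring.
have := vE y x t%:num Ey Ex; rewrite ge0 le1 => /(_ isT).
by congr E; rewrite /conv/= /unstable.onem; apply/rowP => i; rewrite !mxE; ring.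
Qed.

Definition truncation a E : set 'rV[R]_m := E `&` eball a (2 * edist a E).

Lemma edist_le a E z : E z -> edist a E <= enorm (a - z).
Proof.
move=> Ez; apply: ge_inf; last by exists z.
by exists 0 => _ [y _ <-]; exact: enorm_ge0.
Qed.

Lemma le_edist a E (s : R) : E !=set0 -> (forall z, E z -> s <= enorm (a - z)) ->
  s <= edist a E.
Proof.
move=> [z Ez] Es; apply: lb_le_inf; first by exists (enorm (a - z)), z.
by move=> _ [y Ey <-]; exact: Es.
Qed.

Lemma edist_ge0 a E : E !=set0 -> 0 <= edist a E.
Proof. by move=> E0; apply: le_edist => // z _; exact: enorm_ge0. Qed.

Lemma edist_lt a E (s : R) : E !=set0 -> edist a E < s ->
  exists2 z, E z & enorm (a - z) < s.
Proof.
move=> E0; apply: contraPP => /forall2NP h; apply/negP; rewrite -leNgt.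
apply: le_edist => // z Ez; have [//|/negP] := h z.
by rewrite -leNgt.
Qed.

Lemma truncation_nonempty a E : closed E -> E !=set0 -> truncation a E !=set0.
Proof.
move=> cE E0; have [d0|d0] := leP (edist a E) 0.
  have {}d0 : edist a E = 0 by apply/le_anti; rewrite d0 edist_ge0.
  exists a; split; last by rewrite /eball/= d0 mulr0 subrr enorm0.
  apply: closed_enormP => // e e0.
  have [|z Ez za] := @edist_lt a E e E0; first by rewrite d0.
  by exists z => //; rewrite enormBC.
have [|z Ez za] := @edist_lt a E (2 * edist a E) E0; first by lra.
by exists z; split => //; rewrite /eball/= enormBC ltW.
Qed.

Lemma truncation_compact a E : closed E -> compact (truncation a E).
Proof. exact: closed_eball_compact. Qed.

Lemma support_fun_le_near K1 K2 (M e : R) x : K1 !=set0 -> K2 `<=` eball 0 M ->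
  (forall z, K1 z -> exists2 w, K2 w & enorm (z - w) <= e) ->
  support_fun K1 x <= support_fun K2 x + e * enorm x.
Proof.
move=> K10 K2M K12; apply: support_fun_le => // z /K12[w Kw zw].
rewrite -(subrK w z) dotDr addrC lerD//; first exact: le_support_fun K2M Kw.
rewrite (le_trans (dot_le_enorm _ _))// mulrC.
by rewrite ler_wpM2r// enorm_ge0.
Qed.

End truncation.

Section converging_sets.
Local Notation edist := Defs.edist.
Context (R : realType) (m : nat) (I : Type) (F : set_system I) {FF : Filter F}.
Variables (E : set 'rV[R]_m) (E_ : I -> set 'rV[R]_m).
Variables (a : 'rV[R]_m) (a_ : I -> 'rV[R]_m).
Hypotheses (cE : closed E) (vE : convex_set E) (E0 : E !=set0).
Hypotheses (cE_ : forall i, closed (E_ i)) (E_0 : forall i, E_ i !=set0).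

(* [limsupE] and [liminfE] together are Painleve-Kuratowski convergence: cluster
   points of points of the [E_ i] belong to [E], and all points of [E] are
   limits of points of the [E_ i]. *)
Hypothesis limsupE :
  forall z, ~ E z -> \forall z' \near z & i \near F, ~ E_ i z'.

Hypothesis liminfE : forall z (e : R), E z -> 0 < e ->
  \forall i \near F, exists2 z', E_ i z' & enorm (z' - z) <= e.

Hypothesis cvga : a_ @ F --> a.

Let d := edist a E.
Let d_ i := edist (a_ i) (E_ i).
Let K := truncation a E.
Let K_ i := truncation (a_ i) (E_ i).

Let d0 : 0 <= d. Proof. exact: edist_ge0. Qed.

Let near_a (e : R) : 0 < e -> \forall i \near F, enorm (a_ i - a) < e.
Proof. by move=> e0; exact: cvg_enorm_lt. Qed.

(** A nearly closest point of [E] is approached by points of the [E_ i], which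
bounds the distances from above. In the other direction, by compactness of a
ball around [a], points of [E_ i] in this ball are near points of [E]. *)
Lemma cvg_edist (e : R) : 0 < e -> \forall i \near F, `|d_ i - d| <= e.
Proof.
move=> e0; have e3 : 0 < e / 3 by rewrite divr_gt0.
have [|z Ez za] := @edist_lt _ _ a E (d + e / 3) E0; first by rewrite ltrDl.
have far : \forall i \near F,
    forall z', eball a (d + 1) z' -> E_ i z' -> d - e <= enorm (a_ i - z').
  apply: compact_near (@eball_compact _ _ a (d + 1)) _ => w _.
  have [Ew|/limsupE] := pselect (E w); last first.
    by apply: filterS => -[z' i] /= nE /nE.
  near=> z' i => _ /=.
  have h1 : enorm (z' - w) < e / 3 by near: z'; exact: near_enorm_lt.
  have h2 : enorm (a_ i - a) < e / 3 by near: i; exact: near_a.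
  have h3 : d <= enorm (a - w) by exact: edist_le.
  have := ler_enorm_distD (a_ i) a w; have := ler_enorm_distD z' (a_ i) w.
  by rewrite (enormBC a (a_ i)); lra.
near=> i.
have a1 : enorm (a_ i - a) < Num.min (e / 3) 1.
  by near: i; apply: near_a; rewrite lt_min e3 ltr01.
move: a1; rewrite lt_min => /andP[a1 a2].
rewrite ler_distl; apply/andP; split.
  apply: le_edist => // w Ew; have [wC|wC] := leP (enorm (w - a)) (d + 1).
    by move: w wC Ew; near: i; exact: far.
  have := ler_enorm_distD (a_ i) w a; rewrite (enormBC w (a_ i)); lra.
have [w Ew wz] : exists2 z', E_ i z' & enorm (z' - z) <= e / 3.
  by near: i; exact: liminfE.
rewrite (le_trans (edist_le (a_ i) Ew))//.
have := ler_enorm_distD a (a_ i) w; have := ler_enorm_distD z a w.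
by rewrite (enormBC z w); lra.
Unshelve. all: by end_near. Qed.

(** A point of a large ball around [a] outside [K] either is outside [E], or is
strictly further from [a] than the radius; both persist for nearby points and
large [i], and the compactness of the ball makes this uniform. *)
Lemma truncation_near (e : R) : 0 < e -> \forall i \near F,
  forall z, K_ i z -> exists2 w, K w & enorm (z - w) <= e.
Proof.
move=> e0.
have cov : \forall i \near F, forall z, eball a (2 * d + 2) z ->
    K_ i z -> exists2 w, K w & enorm (z - w) <= e.
  apply: compact_near (@eball_compact _ _ a (2 * d + 2)) _ => z _.
  have [Kz|nKz] := pselect (K z).
    near=> z' i => _ /=; exists z => //.
    by apply: ltW; near: z'; exact: near_enorm_lt.
  have [Ez|/limsupE] := pselect (E z); last first.
    by apply: filterS => -[z' i] /= nE [/nE].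
  have gap : 0 < (enorm (z - a) - 2 * d) / 5.
    rewrite divr_gt0// subr_gt0 ltNge; apply/negP => za; exact: nKz.
  near=> z' i => /= -[_]; rewrite /eball/= => za.
  have h1 : enorm (z' - z) < (enorm (z - a) - 2 * d) / 5.
    by near: z'; exact: near_enorm_lt.
  have h2 : enorm (a_ i - a) < (enorm (z - a) - 2 * d) / 5.
    by near: i; exact: near_a.
  have : `|d_ i - d| <= (enorm (z - a) - 2 * d) / 5.
    by near: i; exact: cvg_edist.
  rewrite ler_norml => /andP[_ h3]; move: za; rewrite -/(d_ i) => za.
  have := ler_enorm_distD z' z a; have := ler_enorm_distD (a_ i) z' a.
  by rewrite (enormBC z z'); lra.
near=> i => z Kz.
suff za : eball a (2 * d + 2) z by move: z za Kz; near: i; exact: cov.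
have : `|d_ i - d| <= 1 / 2 by near: i; apply: cvg_edist.
rewrite ler_norml => /andP[_ h3].
have h2 : enorm (a_ i - a) < 1 by near: i; exact: near_a.
have := ler_enorm_distD (a_ i) z a.
by move: Kz => [_]; rewrite /eball/= -/(d_ i); lra.
Unshelve. all: by end_near. Qed.

(** The ball has twice the distance as its radius, so a point of the truncation
can be moved towards a nearly closest point of [E], into the interior of the
ball; nearby points of [E_ i] then lie in the ball around [a_ i]. At distance
zero the truncation is [[set a]], and the balls around [a_ i] shrink to [a]. *)
Lemma near_truncation_point (e : R) z : 0 < e -> K z ->
  \forall i \near F, exists2 w, K_ i w & enorm (w - z) <= e.
Proof.
move=> e0 [Ez]; rewrite /eball/= -/d => za.
have [dpos|dneg] := ltP 0 d; last first.
  have dz : d = 0 by apply/le_anti; rewrite dneg d0.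
  have {}za : z = a.
    apply/eqP; rewrite -subr_eq0; apply/eqP/enorm0_eq0/le_anti.
    by rewrite enorm_ge0 andbT (le_trans za)// dz mulr0.
  near=> i; have [w Kw] := truncation_nonempty (a_ i) (@cE_ i) (E_0 i).
  exists w => //; have := ler_enorm_distD (a_ i) w a.
  have : `|d_ i - d| <= e / 4 by near: i; apply: cvg_edist; rewrite divr_gt0.
  rewrite ler_norml => /andP[_ h3].
  have h2 : enorm (a_ i - a) < e / 2 by near: i; apply: near_a; rewrite divr_gt0.
  by move: Kw => [_]; rewrite /eball/= -/(d_ i) za; lra.
have [|z0 Ez0 z0a] := @edist_lt _ _ a E (3 / 2 * d) E0; first by rewrite -/d; lra.
(* [z] is within [2 d] of [a] and [z0] within [3 d / 2], so moving by the
   fraction [t] displaces [z] by at most [4 d t <= e / 2], and gains [t d / 2]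
   of distance from the boundary of the ball. *)
pose t := Num.min 1 (e / (8 * d)).
have t0 : 0 < t by rewrite lt_min ltr01 divr_gt0// mulr_gt0.
have t1 : t <= 1 by rewrite ge_min lexx.
have te : t * (8 * d) <= e.
  by rewrite -ler_pdivlMr ?mulr_gt0// ge_min lexx orbT.
have Ezt : E (z + t *: (z0 - z)) by apply: (convex_setP E).1 => //; rewrite (ltW t0).
set zt := z + _ in Ezt.
have zta : enorm (zt - a) <= 2 * d - t * d / 2.
  have -> : zt - a = (1 - t) *: (z - a) + t *: (z0 - a).
    by apply/rowP => i; rewrite !mxE; ring.
  rewrite (le_trans (ler_enormD _ _))// !enormZ ger0_norm ?subr_ge0//.
  rewrite (gtr0_norm t0) (enormBC z0 a).
  have : (1 - t) * enorm (z - a) <= (1 - t) * (2 * d).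
    by rewrite ler_wpM2l ?subr_ge0.
  have : t * enorm (a - z0) <= t * (3 / 2 * d).
    by rewrite ler_wpM2l ?(ltW t0)// ltW.
  by lra.
have ztz : enorm (zt - z) <= e / 2.
  rewrite /zt addrAC subrr add0r enormZ (gtr0_norm t0).
  have : enorm (z0 - z) <= 4 * d.
    by have := ler_enorm_distD a z0 z; rewrite (enormBC z0 a) (enormBC a z); lra.
  by nra.
have td : 0 < t * d / 8 by rewrite divr_gt0// mulr_gt0.
near=> i.
have [w Ew wz] : exists2 z', E_ i z' & enorm (z' - zt) <= Num.min (e / 2) (t * d / 8).
  by near: i; apply: liminfE => //; rewrite lt_min td divr_gt0.
move: wz; rewrite le_min => /andP[w1 w2].
exists w; last by have := ler_enorm_distD zt w z; lra.
split => //; rewrite /eball/= -/(d_ i).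
have : `|d_ i - d| <= t * d / 8 by near: i; exact: cvg_edist.
rewrite ler_norml => /andP[h3 _].
have h2 : enorm (a_ i - a) < t * d / 8 by near: i; exact: near_a.
have := ler_enorm_distD zt w (a_ i); have := ler_enorm_distD a zt (a_ i).
by rewrite (enormBC a (a_ i)); lra.
Unshelve. all: by end_near. Qed.

Lemma near_truncation (e : R) : 0 < e -> \forall i \near F,
  forall z, K z -> exists2 w, K_ i w & enorm (z - w) <= e.
Proof.
move=> e0; have e2 : 0 < e / 2 by rewrite divr_gt0.
apply: compact_near (truncation_compact (a := a) cE) _ => z Kz.
near=> z' i.
have [w Kw wz] : exists2 w, K_ i w & enorm (w - z) <= e / 2.
  by near: i; exact: near_truncation_point.
exists w => //; have h : enorm (z' - z) < e / 2 by near: z'; exact: near_enorm_lt.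
by have := ler_enorm_distD z z' w; rewrite (enormBC z w); lra.
Unshelve. all: by end_near. Qed.

(** The truncations are uniformly bounded and converge in the Hausdorff
distance, so their support functions converge uniformly on bounded sets. *)
Lemma steiner_truncation_cvg : steiner (K_ i) @[i --> F] --> steiner K.
Proof.
apply: enorm_cvgP => e e0.
pose M := enorm a + 2 * d + 3.
have M0 : 0 <= M by rewrite !addr_ge0// ?enorm_ge0// mulr_ge0.
have [c c0 cP] := @steiner_continuous R m M e M0 e0.
have c2 : 0 < c / 2 by rewrite divr_gt0.
near=> i.
have KM : K `<=` eball 0 M.
  move=> z [_]; rewrite /eball/= subr0 -/d => za.
  by have := ler_enormD (z - a) a; rewrite subrK /M; lra.
have K_M : K_ i `<=` eball 0 M.
  move=> z [_]; rewrite /eball/= subr0 -/(d_ i) => za.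
  have : `|d_ i - d| <= 1 by near: i; apply: cvg_edist.
  rewrite ler_norml => /andP[_ h3].
  have h2 : enorm (a_ i - a) < 1 by near: i; exact: near_a.
  have := ler_enormD (z - a_ i) (a_ i - a).
  rewrite addrA subrK; have := ler_enormD (z - a) a.
  by rewrite subrK /M; lra.
have K0 : K !=set0 by exact: truncation_nonempty.
have K_0 : K_ i !=set0 by exact: truncation_nonempty.
apply: cP => //; [exact: truncation_compact|exact: truncation_compact|].
move=> x x2.
have s1 : support_fun (K_ i) x <= support_fun K x + c / 2 * enorm x.
  by apply: support_fun_le_near KM _ => //; near: i; exact: truncation_near.
have s2 : support_fun K x <= support_fun (K_ i) x + c / 2 * enorm x.
  by apply: support_fun_le_near K_M _ => //; near: i; exact: near_truncation.
have cx : c / 2 * enorm x <= c by nra.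
by rewrite ler_norml; lra.
Unshelve. all: by end_near. Qed.

End converging_sets.

(** * Epigraphs of conjugates *)

Section epigraph.
Context (R : realType) (n : nat).
Implicit Types (h : 'rV[R]_n -> R) (p q : 'rV[R]_n) (z : 'rV[R]_(n + 1)).

Local Notation convex h := (convex_function [set: 'rV[R]_n] h).

Lemma convex_functionP h : convex h <-> forall p q (t : R), 0 <= t <= 1 ->
  h (p + t *: (q - p)) <= h p + t * (h q - h p).
Proof.
split=> [vh p q t /andP[t0 t1]|vh t p q _ _].
  have := vh (Itv01 t0 t1) q p; rewrite !inE => /(_ I I).
  rewrite convRE /= /unstable.onem /conv/= => vpq.
  rewrite (_ : p + _ = t *: q + (1 - t) *: p).
    by rewrite (le_trans vpq)// le_eqVlt; apply/predU1P; left; ring.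
  by apply/rowP => i; rewrite !mxE; ring.
have := vh q p t%:num; rewrite ge0 le1 => /(_ isT) vpq.
rewrite convRE /conv/= /unstable.onem; rewrite (_ : _ + _ = q + t%:num *: (p - q)).
  by rewrite (le_trans vpq)// le_eqVlt; apply/predU1P; left; ring.
by apply/rowP => i; rewrite !mxE; ring.
Qed.

Definition affine_pt (p : 'rV[R]_n) (s : R) : 'rV[R]_(n + 1) :=
  row_mx p (const_mx s).

(** The epigraph of the convex conjugate of [h], written as an intersection of
half-spaces so that it is visibly closed and convex. *)
Definition conjugate_epi h : set 'rV[R]_(n + 1) :=
  [set z | forall p, dot z (affine_pt p (-1)) <= h p].

Lemma dot_affine_pt z p s :
  dot z (affine_pt p s) = dot (lsubmx z) p + s * rsubmx z ord0 ord0.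
Proof.
rewrite /dot big_split_ord/= big_ord_recl big_ord0 addr0; congr (_ + _).
  by apply: eq_bigr => i _; rewrite row_mxEl !mxE.
by rewrite row_mxEr !mxE mulrC.
Qed.

Lemma enorm_affine_pt p s : enorm (affine_pt p s) <= enorm p + `|s|.
Proof.
rewrite -(@ler_pXn2r _ 2)// ?nnegrE ?addr_ge0 ?enorm_ge0//.
rewrite sqr_enorm dot_affine_pt row_mxKl row_mxKr mxE -sqr_enorm sqrrD.
rewrite real_normK ?num_real// -expr2 lerD2r lerDl mulrn_wge0//.
by rewrite mulr_ge0// enorm_ge0.
Qed.

Lemma epi_lagrangianE (H : R -> 'rV[R]_n -> 'rV[R]_n -> R) t x :
  epi_lagrangian H t x = conjugate_epi (H t x).
Proof.
apply/seteqP; split=> z; rewrite /epi_lagrangian/= => h.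
  move=> p; rewrite dot_affine_pt mulN1r lerBlDr addrC -lerBlDr -lee_fin.
  by apply: le_trans h; apply: ereal_sup_ubound; exists p.
apply: ge_ereal_sup => _ [p _ <-]; rewrite lee_fin.
by have := h p; rewrite dot_affine_pt mulN1r; lra.
Qed.

Lemma closed_conjugate_epi h : closed (conjugate_epi h).
Proof.
rewrite (_ : conjugate_epi h =
    \bigcap_p ((dot (affine_pt p (-1))) @^-1` [set s | s <= h p])).
  apply: closed_bigI => q _; apply: preimage_closed; last exact: closed_le.
  by move=> x _; exact: dot_continuous.
by apply/seteqP; split=> [z hz q _|z hz q]; [have := hz q|have := hz q I];
  rewrite /= dotC.
Qed.

Lemma convex_conjugate_epi h : convex_set (conjugate_epi h).
Proof.
apply/convex_setP => z w t hz hw t01 p; have := hz p; have := hw p.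
by rewrite dotDl dotZl dotBl; nra.
Qed.

(** An interior minimiser [p0] of [h + alpha/2 |.|^2] on a ball is a global
minimiser by convexity, and then [- alpha p0] is a subgradient of [h] at [p0]. *)
Lemma quadratic_minimum h (alpha r : R) : continuous h -> convex h ->
  0 < alpha -> 0 < r ->
  (forall p, enorm p <= r -> h 0 - h p < alpha / 2 * r ^+ 2) ->
  exists p0, [/\ enorm p0 < r, h p0 + alpha / 2 * enorm p0 ^+ 2 <= h 0 &
    forall p, h p0 - alpha * dot p0 (p - p0) <= h p].
Proof.
move=> ch vh alpha0 r0 hr.
pose phi p := h p + alpha / 2 * dot p p.
have cphi : continuous phi.
  move=> p; apply: (@cvgD _ _ _ (nbhs p)); first exact: ch.
  apply: (@cvgM _ _ (nbhs p)); first exact: cvg_cst.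
  have ce := @enorm_continuous R n p.
  by rewrite -sqr_enorm; under eq_fun do rewrite -sqr_enorm; exact: (cvgM ce ce).
have [|||p0] := @compact_EVT_min _ _ phi (eball 0 r).
- by exists 0; rewrite /eball/= subrr enorm0 ltW.
- exact: eball_compact.
- exact: continuous_subspaceT.
rewrite inE /eball/= subr0 => p0r p0min.
have p0le : h p0 + alpha / 2 * enorm p0 ^+ 2 <= h 0.
  rewrite sqr_enorm (le_trans (p0min 0 _))//.
    by rewrite inE /eball/= subrr enorm0 ltW.
  by rewrite /phi dot0l mulr0 addr0.
have {}p0r : enorm p0 < r.
  have a2 : 0 < alpha / 2 by rewrite divr_gt0.
  rewrite -(@ltr_pXn2r _ 2)// ?nnegrE ?enorm_ge0 ?(ltW r0)// -(ltr_pM2l a2).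
  by have := hr p0 p0r; lra.
exists p0; split => // p.
rewrite -subr_ge0 leNgt; apply/negP.
set A := h p - _ => A0.
have [D0 N0] := (dot_ge0 (p - p0), enorm_ge0 (p - p0)).
have N1 : 0 < enorm (p - p0) + 1 by rewrite ltr_wpDl.
have D1 : 0 < alpha * dot (p - p0) (p - p0) + 1.
  by rewrite ltr_wpDl// mulr_ge0// ltW.
(* For small [t], the point [p0 + t (p - p0)] stays in the ball, and the
   quadratic term [alpha / 2 * t ^ 2 * |p - p0| ^ 2] is less than [- t A]. *)
pose t := Num.min 1 (Num.min ((r - enorm p0) / (enorm (p - p0) + 1))
   (- A / (alpha * dot (p - p0) (p - p0) + 1))).
have t0 : 0 < t.
  by rewrite !lt_min ltr01 !divr_gt0//= ?oppr_gt0// subr_gt0.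
have t1 : t <= 1 by rewrite ge_min lexx.
have tr : t * (enorm (p - p0) + 1) <= r - enorm p0.
  by rewrite -ler_pdivlMr// !ge_min lexx orbT.
have tA : t * (alpha * dot (p - p0) (p - p0) + 1) <= - A.
  by rewrite -ler_pdivlMr// !ge_min lexx !orbT.
have := p0min (p0 + t *: (p - p0)).
rewrite inE /eball/= subr0 => /(_ _)/wrap[].
  rewrite (le_trans (ler_enormD _ _))// enormZ gtr0_norm//; nra.
rewrite /phi dotDl !dotDr !dotZl !dotZr (dotC _ p0).
have := (convex_functionP h).1 vh p0 p t; rewrite (ltW t0) t1 => /(_ isT).
move: A0 tA; rewrite /A.
move: (dot (p - p0) (p - p0)) (dot p0 (p - p0)) D0 => D E D0 *.
have : 0 < t * t by rewrite mulr_gt0.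
by nra.
Qed.

(** A subgradient of [h] at one point gives an affine minorant; with a large
weight the quadratic penalty dominates the oscillation of [h] on the unit ball
and forces the minimiser into its interior. *)
Lemma conjugate_epi_nonempty h : continuous h -> convex h ->
  conjugate_epi h !=set0.
Proof.
move=> ch vh.
have [|||q] := @compact_EVT_min _ _ h (eball 0 1).
- by exists 0; rewrite /eball/= subrr enorm0.
- exact: eball_compact.
- exact: continuous_subspaceT.
rewrite inE => _ qmin.
have hq : 0 <= h 0 - h q.
  by rewrite subr_ge0 qmin// inE /eball/= subrr enorm0.
have al0 : 0 < 2 * (h 0 - h q) + 1 by rewrite ltr_wpDl// mulr_ge0.
have [|p0 [_ _ p0P]] := quadratic_minimum ch vh al0 ltr01.
  move=> p p1; have : h q <= h p by apply: qmin; rewrite inE /eball/= subr0.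
  by rewrite expr1n; lra.
set al := 2 * _ + 1 in p0P.
exists (affine_pt (- al *: p0) (- (h p0 + al * dot p0 p0))) => p.
rewrite dot_affine_pt row_mxKl row_mxKr mxE dotZl.
by have := p0P p; rewrite dotBr; lra.
Qed.

Section convergence.
Context (I : Type) (F : set_system I) {FF : Filter F}.
Variables (h : 'rV[R]_n -> R) (h_ : I -> 'rV[R]_n -> R).

(* Continuous convergence; it is equivalent to locally uniform convergence when
   the limit is continuous. *)
Hypothesis cvgh : forall p (e : R), 0 < e ->
  \forall q \near p & i \near F, `|h_ i q - h p| <= e.

(** A point outside the epigraph violates one of the half-spaces strictly, and a
single strict inequality persists. *)
Lemma limsup_conjugate_epi z : ~ conjugate_epi h z ->
  \forall z' \near z & i \near F, ~ conjugate_epi (h_ i) z'.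
Proof.
move=> /existsNP[p /negP]; rewrite -ltNge => hz.
set P := affine_pt p (-1) in hz.
have e0 : 0 < (dot z P - h p) / 3 by rewrite divr_gt0// subr_gt0.
have c : {for z, continuous (dot P)} by exact: dot_continuous.
have hp : \forall i \near F, `|h_ i p - h p| <= (dot z P - h p) / 3.
  by have [[U V] [/= /nbhs_singleton Up FV] UV] := cvgh p e0;
    apply: filterS FV => i Vi; exact: (UV (p, i)).
near=> z' i.
have h1 : `|dot P z - dot P z'| <= (dot z P - h p) / 3.
  by near: z'; move/cvgrPdist_le : c; exact.
have h2 : `|h_ i p - h p| <= (dot z P - h p) / 3 by near: i.
move=> /(_ p); rewrite -/P => h3.
move: h1 h2; rewrite !(dotC P) !ler_norml => /andP[_ h1] /andP[_ h2]; lra.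
Unshelve. all: by end_near. Qed.

Hypotheses (ch : continuous h) (ch_ : forall i, continuous (h_ i))
  (vh_ : forall i, convex (h_ i)).

Lemma near_uniform_ball (e r : R) : 0 < e ->
  \forall i \near F, forall p, eball 0 r p -> `|h_ i p - h p| <= e.
Proof.
move=> e0; have e2 : 0 < e / 2 by rewrite divr_gt0.
apply: compact_near (@eball_compact _ _ 0 r) _ => p _.
have chp : h q @[q --> p] --> h p by exact: ch.
have hq : \forall q \near p, `|h p - h q| <= e / 2.
  by move/(@cvgrPdist_le _ _ _ (nbhs p)) : chp; exact.
have := cvgh p e2; apply: filter_app; near=> q i => /= h2.
have h1 : `|h p - h q| <= e / 2 by near: q.
by have := ler_normD (h_ i q - h p) (h p - h q); rewrite addrA subrK; lra.
Unshelve. all: by end_near. Qed.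

(** Tilting by [z] reduces to a function [g >= 0]. Then [g_i] is almost
nonnegative on a large ball, and penalising it by a small multiple of
[|p|^2] yields an affine minorant of [g_i] whose slope and constant term are
small. *)
Lemma liminf_conjugate_epi z (e : R) : conjugate_epi h z -> 0 < e ->
  \forall i \near F,
    exists2 z', conjugate_epi (h_ i) z' & enorm (z' - z) <= e.
Proof.
move=> hz e0; pose P p := affine_pt p (-1).
(* [al] makes the slope [al * |p0|] at most [eps] once
   [al / 2 * |p0| ^ 2 <= C], and [r] is so large that the penalty exceeds the
   oscillation [C] on the sphere of radius [r]. *)
pose eps := Num.min (e / 2) 1.
have eps0 : 0 < eps by rewrite lt_min ltr01 divr_gt0.
have eps1 : eps <= 1 by rewrite ge_min lexx orbT.
have epse : eps <= e / 2 by rewrite ge_min lexx.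
pose C := h 0 - dot z (P 0) + 2.
have C2 : 2 <= C by rewrite lerDr subr_ge0 hz.
have C0 : 0 < C by lra.
pose al := eps ^+ 2 / (2 * C).
have al0 : 0 < al by rewrite divr_gt0 ?exprn_gt0// mulr_gt0.
pose r := 2 * C / al + 1.
have Cal : 0 < 2 * C / al by rewrite divr_gt0// mulr_gt0.
have r1 : 1 <= r by rewrite lerDr ltW.
have rC : C < al / 2 * r ^+ 2.
  have : al * (2 * C / al) = 2 * C by rewrite mulrC divfK// gt_eqF.
  rewrite /r; move: (2 * C / al) Cal => s s0 sC; rewrite sqrrD; nra.
near=> i.
have hi : forall p, eball 0 r p -> `|h_ i p - h p| <= eps.
  by near: i; exact: near_uniform_ball.
pose g p := h_ i p - dot z (P p).
have dotP p q t : dot z (P (p + t *: (q - p))) =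
    dot z (P p) + t * (dot z (P q) - dot z (P p)).
  by rewrite !dot_affine_pt dotDr dotZr dotBr; ring.
have cg : continuous g.
  move=> p; apply: (@cvgB _ _ _ (nbhs p)); first exact: ch_.
  under eq_fun do rewrite dot_affine_pt; rewrite dot_affine_pt.
  by apply: (@cvgD _ _ _ (nbhs p)); [exact: dot_continuous|exact: cvg_cst].
have vg : convex g.
  apply/convex_functionP => p q t t01; rewrite /g dotP.
  by have := (convex_functionP _).1 (vh_ i) p q t t01; lra.
have g_ge p : eball 0 r p -> - eps <= g p.
  by move=> /hi; rewrite ler_norml => /andP[+ _]; have := hz p; rewrite -/(P p) /g; lra.
have g0 : g 0 <= C - 1.
  have : eball 0 r (0 : 'rV[R]_n) by rewrite /eball/= subrr enorm0; lra.
  by move=> /hi; rewrite ler_norml => /andP[_]; rewrite /g /C; lra.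
have [||p0 [p0r p0le p0P]] := @quadratic_minimum g al r cg vg al0.
- by lra.
- move=> p pr; have : - eps <= g p by apply: g_ge; rewrite /eball/= subr0.
  by lra.
have gp0 : - eps <= g p0 by apply: g_ge; rewrite /eball/= subr0 ltW.
exists (z + affine_pt (- al *: p0) eps).
  move=> p; rewrite dotDl [dot (affine_pt _ _) _]dot_affine_pt.
  rewrite row_mxKl row_mxKr mxE dotZl.
  have := p0P p; rewrite dotBr -sqr_enorm {2}/g -/(P p).
  by have := sqr_ge0 (enorm p0); nra.
rewrite addrC addKr (le_trans (enorm_affine_pt _ _))//.
rewrite enormZ normrN (gtr0_norm al0) (gtr0_norm eps0).
suff : al * enorm p0 <= eps by lra.
have alp0 : 0 <= al * enorm p0.
  by apply: mulr_ge0; [exact: ltW|exact: enorm_ge0].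
rewrite -(@ler_pXn2r _ 2)// ?nnegrE ?(ltW eps0)//.
have alC : al * (2 * C) = eps ^+ 2 by rewrite divfK// gt_eqF// mulr_gt0.
rewrite -alC exprMn.
have : al / 2 * enorm p0 ^+ 2 <= C by lra.
by nra.
Unshelve. all: by end_near. Qed.

End convergence.

End epigraph.

(** * The canonical representation *)

Lemma cvg_compactP (R : realType) (U V : topologicalType)
    (W : pseudoMetricType R) (g_ : nat -> U -> V -> W) (g : U -> V -> W) :
  cvg_compact g_ g <-> forall K : set (U * V), compact K ->
    forall e : R, 0 < e ->
    \forall i \near \oo, forall z, K z -> ball (g z.1 z.2) e (g_ i z.1 z.2).
Proof.
split=> [/fam_cvgP gK K cK e e0|gK].
  have := gK K cK [set f | forall z, K z -> ball (g z.1 z.2) e (f z)]; apply.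
  apply/uniform_nbhs; exists [set xy | ball xy.1 e xy.2]; split=> //.
  exact: (entourage_ball W (PosNum e0)).
apply/fam_cvgP => K cK P /uniform_nbhs[E []].
rewrite -entourage_from_ballE => -[e /= e0 eE] EP.
apply: filterS (gK K cK e e0) => i gi; apply: EP => z Kz.
by apply: eE; exact: gi.
Qed.

(** Both functions stay close to [g x] on a neighbourhood of [x], and finitely
many such neighbourhoods cover [K]. *)
Lemma continuous_cvg_compact (R : realType) (X : topologicalType) (m : nat)
    (g_ : nat -> X -> 'rV[R]_m) (g : X -> 'rV[R]_m) :
  (forall x (e : R), 0 < e ->
    \forall z \near x & i \near \oo, enorm (g_ i z - g x) < e) ->
  (forall x (e : R), 0 < e ->
    \forall z \near x & i \near \oo, enorm (g z - g x) < e) ->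
  forall K : set X, compact K -> forall e : R, 0 < e ->
  \forall i \near \oo, forall z, K z -> enorm (g_ i z - g z) < e.
Proof.
move=> gg cg K cK e e0; have e2 : 0 < e / 2 by rewrite divr_gt0.
apply: compact_near cK _ => x _.
have := gg x _ e2; have := cg x _ e2; apply: filter_app2.
near=> z i => /= h1 h2; have := ler_enorm_distD (g x) (g_ i z) (g z).
by rewrite (enormBC (g x)); lra.
Unshelve. all: by end_near. Qed.

Section representation_convergence.
Context (R : realType) (n : nat).
Implicit Types (H : R -> 'rV[R]_n -> 'rV[R]_n -> R) (t : R) (x p : 'rV[R]_n).

Lemma admissible_convex_continuous (T : R) H t x : admissible T H ->
  t \in `[0, T] ->
  continuous (H t x) /\ convex_function [set: 'rV[R]_n] (H t x).
Proof.
move=> admH tT; split; last exact: (admissible_convex admH tT).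
move=> p; apply: (@continuous2_cvg _ _ _ _ (nbhs p) _ (fun=> x) id (H t)
  x p).
- exact: (@admissible_continuous _ _ _ _ admH t tT (x, p)).
- exact: cvg_cst.
- exact: cvg_id.
Qed.

Local Notation fun2 H t := (fun z : 'rV[R]_n * 'rV[R]_n => H t z.1 z.2).

(** Moving the base points [x] and [a] together with the index [i] turns joint
convergence of the representations into convergence of the Steiner points
along a single filter, to which the results on converging sets apply. *)
Lemma repr_e_cvg T t (H_ : nat -> R -> 'rV[R]_n -> 'rV[R]_n -> R) H x a :
  (forall i, admissible T (H_ i)) -> admissible T H -> t \in `[0, T] ->
  (forall z (e : R), 0 < e -> \forall z' \near z & i \near \oo,
    `|fun2 (H_ i) t z' - fun2 H t z| <= e) ->
  forall e : R, 0 < e -> \forall z \near (x, a) & i \near \oo,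
    enorm (repr_e (H_ i) t z.1 z.2 - repr_e H t x a) < e.
Proof.
move=> admH_ admH tT cvgH e e0.
pose I := (('rV[R]_n * 'rV[R]_(n + 1)) * nat)%type.
pose F : set_system I := filter_prod (nbhs (x, a)) \oo.
have FF : Filter F by exact: filter_prod_filter.
have [ch vh] := admissible_convex_continuous x admH tT.
pose h_ (k : I) := H_ k.2 t k.1.1.
have ch_ k : continuous (h_ k).
  by have [] := admissible_convex_continuous k.1.1 (admH_ k.2) tT.
have vh_ k : convex_function [set: 'rV[R]_n] (h_ k).
  by have [] := admissible_convex_continuous k.1.1 (admH_ k.2) tT.
have cvgh p (d : R) : 0 < d ->
    \forall q \near p & k \near F, `|h_ k q - H t x p| <= d.
  move=> d0; have [[W N] [/= [[Wx Wp] [/= xW pW] WW] oN] WN] := cvgH (x, p) d d0.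
  exists (Wp, [set k : I | Wx k.1.1 /\ N k.2]) => /=.
    split=> //; exists ([set z | Wx z.1], N) => /=; last by move=> k [].
    split=> //; exists (Wx, setT) => /=; last by move=> z [].
    by split=> //; exact: filterT.
  move=> [q k] /= [Wq [Wk Nk]]; apply: (WN ((k.1.1, q), k.2)) => /=.
  by split=> //=; exact: WW.
have cvga : k.1.2 @[k --> F] --> a.
  apply: cvg_comp (@cvg_snd _ _ (nbhs x) (nbhs a) _).
  exact: cvg_fst.
have := @steiner_truncation_cvg _ _ _ F FF _ (fun k => conjugate_epi (h_ k))
  _ _ (@closed_conjugate_epi _ _ (H t x)) (@convex_conjugate_epi _ _ (H t x))
  (conjugate_epi_nonempty ch vh) (fun k => @closed_conjugate_epi _ _ (h_ k))
  (fun k => conjugate_epi_nonempty (@ch_ k) (@vh_ k))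
  (limsup_conjugate_epi (FF := FF) cvgh)
  (liminf_conjugate_epi (FF := FF) cvgh ch ch_ vh_) cvga.
move=> /(cvg_enorm_lt FF)/(_ e0); rewrite /truncation => hcvg.
rewrite /repr_e epi_lagrangianE; apply: filterS hcvg => k.
by rewrite epi_lagrangianE.
Qed.

(** A product of closed balls around [z] is a compact neighbourhood of [z]. *)
Lemma continuous_cvg_of_compact t (H_ : nat -> R -> 'rV[R]_n -> 'rV[R]_n -> R) H :
  continuous (fun2 H t) -> cvg_compact (fun i => H_ i t) (H t) ->
  forall z (e : R), 0 < e -> \forall z' \near z & i \near \oo,
    `|fun2 (H_ i) t z' - fun2 H t z| <= e.
Proof.
move=> cH /cvg_compactP HK [x p] e e0; have e2 : 0 < e / 2 by rewrite divr_gt0.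
have cK : compact (eball x 1 `*` eball p 1).
  by apply: compact_setX; exact: eball_compact.
have Knear : nbhs (x, p) (eball x 1 `*` eball p 1).
  exists (eball x 1, eball p 1) => //=; split.
    by apply: filterS (near_enorm_lt x ltr01) => y /ltW.
  by apply: filterS (near_enorm_lt p ltr01) => y /ltW.
have Hnear : \forall z' \near (x, p), `|fun2 H t (x, p) - fun2 H t z'| <= e / 2.
  have cHxp : fun2 H t z' @[z' --> (x, p)] --> fun2 H t (x, p) by exact: cH.
  by move/(@cvgrPdist_le _ _ _ (nbhs (x, p))) : cHxp; exact.
have Hunif := HK _ cK _ e2.
exists ([set z' | (eball x 1 `*` eball p 1) z' /\
    `|fun2 H t (x, p) - fun2 H t z'| <= e / 2],
  [set i | forall z, (eball x 1 `*` eball p 1) z ->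
    ball (H t z.1 z.2) (e / 2) (H_ i t z.1 z.2)]) => /=.
  by split=> //; exact: filterI.
move=> [z' i] /= [[Kz' Hz'] /(_ z' Kz')]; rewrite /ball/= => /ltW Hi.
rewrite [leLHS]distrC (le_trans (ler_distD (H t z'.1 z'.2) _ _))//.
by rewrite [leRHS]splitr lerD.
Qed.

(** The continuity of the limit is the convergence of a constant sequence. *)
Lemma repr_e_cvg_compact T t (H_ : nat -> R -> 'rV[R]_n -> 'rV[R]_n -> R) H :
  (forall i, admissible T (H_ i)) -> admissible T H -> t \in `[0, T] ->
  cvg_compact (fun i => H_ i t) (H t) ->
  forall K : set ('rV[R]_n * 'rV[R]_(n + 1)), compact K ->
  forall e : R, 0 < e -> \forall i \near \oo, forall z, K z ->
    enorm (repr_e (H_ i) t z.1 z.2 - repr_e H t z.1 z.2) < e.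
Proof.
move=> admH_ admH tT HH K cK e e0.
have cH : continuous (fun2 H t) by exact: (admissible_continuous admH tT).
have cstH z (d : R) : 0 < d -> \forall z' \near z & i \near \oo,
    `|fun2 H t z' - fun2 H t z| <= d.
  move=> d0; have cHz : fun2 H t z' @[z' --> z] --> fun2 H t z by exact: cH.
  move/(@cvgrPdist_le _ _ _ (nbhs z)) : cHz => /(_ _ d0) Hz.
  near=> z' i; have : `|fun2 H t z - fun2 H t z'| <= d by near: z'.
  by rewrite distrC.
apply: (@continuous_cvg_compact _ _ _
  (fun i z => repr_e (H_ i) t z.1 z.2) (fun z => repr_e H t z.1 z.2)) cK _ e0.
  move=> [x a]; apply: (@repr_e_cvg T t H_ H x a admH_ admH tT).
  exact: continuous_cvg_of_compact cH HH.
by move=> [x a]; exact: (@repr_e_cvg T t (fun=> H) H x a (fun=> admH) admH tT).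
Unshelve. all: by end_near. Qed.

(** Otherwise the inequality that defines the epigraph fails at [s * v] for large
[s], where [v] is the first component of [z]. *)
Lemma lipschitz_conjugate_epi (C : R) (h : 'rV[R]_n -> R) z : 0 <= C ->
  (forall p q, `|h p - h q| <= C * enorm (p - q)) -> conjugate_epi h z ->
  enorm (lsubmx z) <= C.
Proof.
move=> C0 hC hz; rewrite leNgt; apply/negP => Cz.
set v := lsubmx z in Cz.
have [c0 hc] : exists c0, forall s : R, 0 <= s ->
    s * (enorm v * (enorm v - C)) <= c0.
  exists (rsubmx z ord0 ord0 + h 0) => s s0.
  have := hz (s *: v); rewrite dot_affine_pt dotZr -sqr_enorm.
  have := hC (s *: v) 0; rewrite subr0 enormZ (ger0_norm s0) ler_norml.
  by move=> /andP[_]; lra.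
have v0 : 0 < enorm v * (enorm v - C).
  by rewrite mulr_gt0 ?subr_gt0// (le_lt_trans C0).
have := hc ((`|c0| + 1) / (enorm v * (enorm v - C))).
rewrite divfK ?gt_eqF// => /(_ _)/wrap[]; first by rewrite divr_ge0 ?addr_ge0// ltW.
by have := ler_norm c0; lra.
Qed.

(** With [v] the projection of the Steiner point, [dot z (v, 0) <= C |v|] holds on
the truncated epigraph, hence at the Steiner point, where it reads
[|v| ^ 2 <= C |v|]. *)
Lemma enorm_repr_f_le T t H x a (C : R) : admissible T H -> t \in `[0, T] ->
  0 <= C -> (forall p q, `|H t x p - H t x q| <= C * enorm (p - q)) ->
  enorm (repr_f H t x a) <= C.
Proof.
move=> admH tT C0 HC; have [ch vh] := admissible_convex_continuous x admH tT.
rewrite /repr_f /repr_e epi_lagrangianE -/(truncation _ _).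
set s := steiner _; set v := lsubmx s.
have v2 : dot s (affine_pt v 0) <= C * enorm v.
  apply: steiner_halfspace.
  - by rewrite mulr_ge0// enorm_ge0.
  - by apply: truncation_nonempty;
      [exact: closed_conjugate_epi|exact: conjugate_epi_nonempty].
  - by apply: truncation_compact; exact: closed_conjugate_epi.
  move=> z [hz _]; rewrite dot_affine_pt mul0r addr0.
  rewrite (le_trans (dot_le_enorm _ _))// ler_wpM2r ?enorm_ge0//.
  exact: lipschitz_conjugate_epi hz.
move: v2; rewrite dot_affine_pt mul0r addr0 -/v -sqr_enorm.
by have := enorm_ge0 v; nra.
Qed.

Lemma enorm_lsubmx_le (z : 'rV[R]_(n + 1)) : enorm (lsubmx z) <= enorm z.
Proof.
have [z0|z0] := eqVneq (enorm (lsubmx z)) 0; first by rewrite z0 enorm_ge0.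
have zpos : 0 < enorm (lsubmx z) by rewrite lt_def z0 enorm_ge0.
rewrite -(ler_pM2r zpos) -expr2 sqr_enorm.
rewrite -[leLHS]addr0 -(mul0r (rsubmx z ord0 ord0)) -dot_affine_pt.
rewrite (le_trans (dot_le_enorm _ _))// ler_wpM2l ?enorm_ge0//.
by rewrite (le_trans (enorm_affine_pt _ _))// normr0 addr0.
Qed.

Lemma normr_rsubmxB_le (z w : 'rV[R]_(n + 1)) :
  `|rsubmx z ord0 ord0 - rsubmx w ord0 ord0| <= enorm (z - w).
Proof. by have := le_coord_enorm (z - w) (rshift n ord0); rewrite !mxE. Qed.

Lemma admissible_lipschitz_repr_f T t H (c : R -> R) x a : admissible T H ->
  t \in `[0, T] -> (forall t, t \in `[0, T] -> 0 <= c t) ->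
  (forall t x p q, t \in `[0, T] ->
    `|H t x p - H t x q| <= c t * (1 + enorm x) * enorm (p - q)) ->
  enorm (repr_f H t x a) <= c t * (1 + enorm x).
Proof.
move=> admH tT c0 Hc; apply: (enorm_repr_f_le _ admH) => //; last first.
  by move=> p q; exact: Hc.
by rewrite mulr_ge0 ?c0// addr_ge0// enorm_ge0.
Qed.

End representation_convergence.

Theorem theorem3p11 (R : realType) (T : R) (n : nat)
    (H_ : nat -> R -> 'rV[R]_n -> 'rV[R]_n -> R)
    (H : R -> 'rV[R]_n -> 'rV[R]_n -> R)
    (admH_ : forall i, admissible T (H_ i)) (admH : admissible T H) :
  ((forall t, t \in `[0, T] -> cvg_compact (fun i => H_ i t) (H t)) ->
    forall t, t \in `[0, T] ->
      cvg_compact (fun i => repr_f (H_ i) t) (repr_f H t) /\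
      cvg_compact (fun i => repr_l (H_ i) t) (repr_l H t)) /\
  (forall (c_ : nat -> R -> R) (c : R -> R),
    (forall i, lebesgue_measurable_fun `[0, T] (c_ i)) ->
    lebesgue_measurable_fun `[0, T] c ->
    (forall i t, t \in `[0, T] -> 0 <= c_ i t) ->
    (forall t, t \in `[0, T] -> 0 <= c t) ->
    (forall i t x p q, t \in `[0, T] ->
      `|H_ i t x p - H_ i t x q| <= c_ i t * (1 + enorm x) * enorm (p - q)) ->
    (forall t x p q, t \in `[0, T] ->
      `|H t x p - H t x q| <= c t * (1 + enorm x) * enorm (p - q)) ->
    (forall i t x a, t \in `[0, T] ->
      enorm (repr_f (H_ i) t x a) <= c_ i t * (1 + enorm x)) /\
    (forall t x a, t \in `[0, T] ->
      enorm (repr_f H t x a) <= c t * (1 + enorm x))).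
Proof.
split=> [HH t tT|c_ c _ _ c_0 c0 H_c Hc]; last first.
  split=> [i t x a tT|t x a tT].
    exact: (admissible_lipschitz_repr_f _ _ (admH_ i) tT (c_0 i) (H_c i)).
  exact: (admissible_lipschitz_repr_f _ _ admH tT c0 Hc).
have He := repr_e_cvg_compact admH_ admH tT (HH t tT).
split; apply/cvg_compactP => K cK e e0; apply: filterS (He K cK e e0) => i Hi z Kz.
  rewrite mx_norm_ball /ball_/= -linearB (le_lt_trans (norm_le_enorm _))//.
  rewrite (le_lt_trans _ (Hi z Kz))// enormBC.
  exact: enorm_lsubmx_le.
rewrite /ball/= distrC (le_lt_trans _ (Hi z Kz))//.
exact: normr_rsubmxB_le.
Qed.
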